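(* Let $\mu$ be a probability measure on $\{0,1\}^{\mathbb Z}$ which is translation-invariant and stationary for the stochastic six-vertex model, and which is extremal. Then $\mu=\Upsilon^{(\rho)}$ for some $\rho\in[0,1]$.
   Context: Fix $0<b_1<b_2<1$. The stochastic six-vertex model is the discrete-time Markov process $(\eta_t)_{t\ge0}$ on particle configurations $\eta\in\{0,1\}^{\mathbb Z}$ defined as follows for finitely many particles: at each step $t$ take independent $\chi_t(x)$ with $P[\chi_t(x)=1]=b_1=1-P[\chi_t(x)=0]$ and $j_t(x)$ with $P[j_t(x)=r]=(1-b_2)b_2^{r-1}$ ($r\ge1$). Label the particles at time $t-1$ as $p_{t-1}(-M)<\dots<p_{t-1}(N)$ (with $p(i)=-\infty$ for $i<-M$, $+\infty$ for $i>N$) and update $k=-M,\dots,N$ in this order: with $x=p_{t-1}(k)$, if $p_t(k-1)<x$ set $p_t(k)=x$ when $\chi_t(x)=1$ and $p_t(k)=\min\{x+j_t(x),p_{t-1}(k+1)\}$ when $\chi_t(x)=0$; if $p_t(k-1)=x$ set $p_t(k)=\min\{x+j_t(x),p_{t-1}(k+1)\}$. For infinitely many particles the dynamics over any finite time horizon is defined by the same rules via a Harris-type construction (almost surely space-time splits into finite non-interacting blocks). For a probability measure $\mu$ on $\{0,1\}^{\mathbb Z}$, $\mathfrak{M}_t\mu$ is the law of $\eta_t$ when $\eta_0\sim\mu$, and $\mathfrak{S}_m\mu$ is the law of $(\eta(x+m))_x$ when $\eta\sim\mu$. $\mu$ is translation-invariant if $\mathfrak{S}_m\mu=\mu$ for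 all $m\in\mathbb Z$, stationary if $\mathfrak{M}_t\mu=\mu$ for all $t\ge0$, and extremal if $\mu=p\mu_1+(1-p)\mu_2$ with $p\in(0,1)$ implies $\mu_1=\mu_2=\mu$. $\Upsilon^{(\rho)}$ is the product Bernoulli measure with $P[\eta(x)=1]=\rho$ for all $x$. *)

(* Defs.v *)
From HB Require Import structures.
From mathcomp Require Import all_boot all_order all_algebra.
From mathcomp Require Import all_classical all_reals all_analysis.
Set Implicit Arguments. Unset Strict Implicit. Unset Printing Implicit Defensive.
Import Order.TTheory GRing.Theory Num.Theory.
Local Open Scope classical_set_scope.
Local Open Scope ring_scope.

(** eta x = true  <->  site x is occupied. *)
Definition cyl_gen : set (set (int -> bool)) :=
  [set A | exists (x : int) (b : bool), A = [set eta | eta x = b]].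

Definition config := g_sigma_algebraType cyl_gen.

Definition shift (m : int) (eta : config) : config := fun x => eta (x + m).

(* chi x : the Bernoulli(b1) "stay" variable at site x                 *)
(* j x   : the Geometric(b2) jump length attempted from site x (>= 1)   *)

(** [pushed_upto eta chi j n z]: the particle at z is pushed, as detected by
    following the chain of pushes leftwards for at most n steps. The particle
    at z is pushed iff the nearest particle w to its left (all sites strictly
    between w and z empty) leaves its site (chi w = 0, or w is itself pushed)
    and its attempted jump reaches z (z <= w + j w). *)
Fixpoint pushed_upto (eta : int -> bool) (chi : int -> bool) (j : int -> nat)
    (n : nat) (z : int) : Prop :=
  match n with
  | 0 => False
  | n'.+1 => exists w : int, [/\ w < z, eta w,
        (forall v : int, w < v < z -> ~~ eta v),
        z <= w + (j w)%:Z
      & ~~ chi w \/ pushed_upto eta chi j n' w]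
  end.

(** Harris construction: the chain of pushes is a.s. finite; [pushed] holds
    iff a finite chain of pushes ends at z (least fixed point). *)
Definition pushed (eta : int -> bool) (chi : int -> bool) (j : int -> nat) (z : int) : Prop := exists n, pushed_upto eta chi j n z.

Definition departs (eta : int -> bool) (chi : int -> bool) (j : int -> nat) (w : int) : Prop :=
  eta w /\ (~~ chi w \/ pushed eta chi j w).

Definition reaches (eta : int -> bool) (chi : int -> bool) (j : int -> nat) (w z : int) : Prop :=
  [/\ w < z, departs eta chi j w,
      (forall v : int, w < v < z -> ~~ eta v) & z <= w + (j w)%:Z].

(** New configuration: y is occupied iff the old particle at y stays, or a
    moving particle stops at y (at w + j w, or at the next particle y). *)
Definition sv_step (eta : config) (chi : int -> bool) (j : int -> nat) : config :=
  fun y => `[< (eta y /\ ~ departs eta chi j y) \/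
              (exists w, reaches eta chi j w y /\ (eta y \/ y = w + (j w)%:Z)) >].

(** index of the basic random elements: None = eta0,
    Some (false, (t, x)) = chi_t(x), Some (true, (t, x)) = j_t(x) *)
Definition sv_index : eqType := option (bool * (nat * int)).

Section Process.
Context {R : realType} {d : measure_display} {Omega : measurableType d}.

Definition sv_events (eta0 : Omega -> config) (chi : nat -> int -> Omega -> bool)
    (j : nat -> int -> Omega -> nat) (i : sv_index) : set (set Omega) :=
  match i with
  | None => [set eta0 @^-1` A | A in [set A : set config | measurable A]]
  | Some (false, (t, x)) => [set chi t x @^-1` B | B in [set: set bool]]
  | Some (true, (t, x)) => [set j t x @^-1` B | B in [set: set nat]]
  end.

(** the random elements actually used: eta0 and chi_t(x), j_t(x) for t >= 1 *)
Definition sv_used (i : sv_index) : bool :=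
  if i is Some (_, (t, _)) then (0 < t)%N else true.

Definition sv_independent (P : probability Omega R) eta0 chi j : Prop :=
  forall (s : seq sv_index) (E : sv_index -> set Omega),
    uniq s -> all sv_used s ->
    (forall i, i \in s -> sv_events eta0 chi j i (E i)) ->
    P (\big[setI/setT]_(i <- s) E i) = (\prod_(i <- s) P (E i))%E.

Fixpoint sv_process (eta0 : Omega -> config) (chi : nat -> int -> Omega -> bool)
    (j : nat -> int -> Omega -> nat) (t : nat) (w : Omega) : config :=
  match t with
  | 0 => eta0 w
  | t'.+1 => sv_step (sv_process eta0 chi j t' w)
                     (fun x => chi t'.+1 x w) (fun x => j t'.+1 x w)
  end.

Definition sv_realization (b1 b2 : R) (mu : probability config R)
    (P : probability Omega R) eta0 chi j : Prop :=
  [/\ measurable_fun setT eta0 /\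
      (forall t x (B : set bool), measurable (chi t x @^-1` B)) /\
      (forall t x (B : set nat), measurable (j t x @^-1` B)),
      (forall A : set config, measurable A -> P (eta0 @^-1` A) = mu A),
      (forall t x, (0 < t)%N -> P (chi t x @^-1` [set true]) = b1%:E),
      (forall t x (r : nat), (0 < t)%N -> (0 < r)%N ->
          P (j t x @^-1` [set r]) = ((1 - b2) * b2 ^+ r.-1)%:E)
    & sv_independent P eta0 chi j].
End Process.

Definition translation_invariant {R : realType} (mu : probability config R) : Prop :=
  forall (m : int) (A : set config), measurable A -> mu (shift m @^-1` A) = mu A.

Definition sv_stationary {R : realType} (b1 b2 : R) (mu : probability config R) : Prop :=
  forall (d : measure_display) (Omega : measurableType d) (P : probability Omega R)
         (eta0 : Omega -> config) chi j,
    sv_realization b1 b2 mu P eta0 chi j ->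
    forall (t : nat) (A : set config), measurable A ->
      P (sv_process eta0 chi j t @^-1` A) = mu A.

Definition ti_stationary {R : realType} (b1 b2 : R) (mu : probability config R) :=
  translation_invariant mu /\ sv_stationary b1 b2 mu.

Definition ti_stationary_extremal {R : realType} (b1 b2 : R) (mu : probability config R) :=
  forall (p : R) (mu1 mu2 : probability config R), 0 < p < 1 ->
    ti_stationary b1 b2 mu1 -> ti_stationary b1 b2 mu2 ->
    (forall A : set config, measurable A -> mu A = (p%:E * mu1 A + (1 - p)%:E * mu2 A)%E) ->
    forall A : set config, measurable A -> mu1 A = mu A /\ mu2 A = mu A.

(** mu is the product Bernoulli measure Upsilon^(rho): its finite-dimensional
    distributions are the products of Bernoulli(rho) marginals (this determines
    the measure on the cylinder sigma-algebra). *)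
Definition is_Upsilon {R : realType} (rho : R) (mu : probability config R) : Prop :=
  forall (s : seq int) (b : int -> bool), uniq s ->
    mu [set eta : config | forall x, x \in s -> eta x = b x] =
    (\prod_(x <- s) (if b x then rho else 1 - rho))%:E.

(* Main.v *)
Require Import Defs.
From HB Require Import structures.
From mathcomp Require Import all_boot all_order all_algebra.
From mathcomp Require Import all_classical all_reals all_analysis.
From mathcomp Require Import measurable_realfun.
From mathcomp Require Import zify ring lra.
Import Order.TTheory GRing.Theory Num.Theory.
Import numFieldNormedType.Exports.
Set Implicit Arguments. Unset Strict Implicit. Unset Printing Implicit Defensive.
Local Open Scope classical_set_scope.
Local Open Scope ring_scope.

(** One step is read from left to right as a row of six-vertex vertices: the
    arrow [h] entering site [x] horizontally and the particle [v] at [x] are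
    turned into the new particle at [x] and the arrow leaving [x], by a kernel
    on {0,1}^2 which is memoryless because the jumps are geometric.

    Given a translation-invariant stationary law, follow the joint law of
    (new particles left of [x], arrow at [x], old particles from [x] on) in a
    block of N sites as [x] runs through the block. Its entropy, corrected by
    the constant density of arrows, increases at every vertex, while its total
    increase is at most ln 2: at both ends the particles have the same law, and
    the arrow carries one bit. By translation invariance the entropy production
    at a vertex vanishes, which is the detailed balance
    P(v = 1, h = 0, rest) = odds * P(v = 0, h = 1, rest), where
    odds = (1 - b2) / (1 - b1).
    Hence the joint law above does not depend on [x], and exchanging twice, a
    particle with the arrow and the arrow with another particle, shows that the
    law of the particles is exchangeable.

    Condition an exchangeable stationary law on the value of one site and forget
    that site. The result is exchangeable, hence translation invariant, and it is
    stationary: put the forgotten site far to the right, where a step does not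
    see it. So the law is a mixture of two translation-invariant stationary laws;
    by extremality they coincide with it, i.e. a site is independent of all the
    others. *)

(** * One step along a fixed noise *)

(** The arrow entering a block comes from an unbounded past, and all that is used about it is that
    it is one bit; this gives the block an entropy budget that does not depend on its length.
    Production is bounded below by squared differences of square roots: if detailed balance failed
    by a fixed amount in some window, each of n translates of that window inside one block would
    cost a fixed positive amount, which exceeds the budget for large n. The constant odds is forced
    by the vertex weights: b1 x + (1 - b2) z equals the convex combination b1 x + (1 - b1) y exactly
    for y = odds z. After this change of weight both outgoing masses are convex combinations of x
    and y, and the price is a multiple of the change in arrow density, which is zero. Stationarity
    quantifies over all realizations of the noise. It yields something about a law only once a
    realization exists, hence the construction of independent digits from one uniform variable; and
    to prove it for the conditioned laws, an arbitrary realization has to be compared with the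
    constructed one. *)

Section OneStepPath.
Variables (eta chi : int -> bool) (j : int -> nat).

(** The horizontal arrow with a residual length: some jump from the left reaches at least [x + e].
    Carrying [e] lets the recursion walk over empty sites one at a time, where [pushed_upto] goes
    from particle to particle; [n] bounds the sites inspected, not the pushes. *)
Fixpoint arrow_upto (n e : nat) (x : int) : bool :=
  match n with
  | 0 => false
  | n'.+1 => if eta (x - 1)
             then (~~ chi (x - 1) || arrow_upto n' 0 (x - 1)) && (e < j (x - 1))%N
             else arrow_upto n' e.+1 (x - 1)
  end.

Definition arrow (e : nat) (x : int) : bool := `[< exists n, arrow_upto n e x >].

Lemma arrow_uptoS n e x : arrow_upto n e x -> arrow_upto n.+1 e x.
Proof.
elim: n e x => [//|n IH] e x.
change (arrow_upto n.+2 e x) with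
  (if eta (x - 1)
   then (~~ chi (x - 1) || arrow_upto n.+1 0 (x - 1)) && (e < j (x - 1))%N
   else arrow_upto n.+1 e.+1 (x - 1)).
rewrite [arrow_upto n.+1 e x]/=; case: (eta _) => [/andP[/orP[->|/IH ->] ->]|/IH //].
all: by rewrite ?orbT.
Qed.

Lemma arrow_upto_le m n e x : (m <= n)%N -> arrow_upto m e x -> arrow_upto n e x.
Proof.
by move=> /subnK <-; elim: (n - m)%N => // k IH /IH; rewrite addSn; exact: arrow_uptoS.
Qed.

(** The local vertex rule, freed from the fuel: a particle absorbs the incoming arrow and emits a
    fresh one, an empty site lets it through. *)
Lemma arrowS e x :
  arrow e (x + 1) =
  if eta x then (~~ chi x || arrow 0 x) && (e < j x)%N else arrow e.+1 x.
Proof.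
have E n : arrow_upto n.+1 e (x + 1) =
    if eta x then (~~ chi x || arrow_upto n 0 x) && (e < j x)%N
    else arrow_upto n e.+1 x by rewrite /= addrK.
apply/asboolP/idP => [[[//|n]]|].
  rewrite E; case: (eta x) => [/andP[/orP[->|h] ->] //|h]; last by apply/asboolP; exists n.
  by rewrite andbT; apply/orP; right; apply/asboolP; exists n.
case: ifPn => ex; first case/andP => /orP[h|/asboolP[n h]] hj; last move=> /asboolP[n h].
- by exists 1; rewrite E ex h hj.
- by exists n.+1; rewrite E ex h hj orbT.
- by exists n.+1; rewrite E (negbTE ex).
Qed.

Lemma arrow_pushedP e z :
  arrow e z <-> exists w : int, [/\ w < z, eta w,
     (forall v : int, w < v < z -> ~~ eta v),
     z + e%:Z <= w + (j w)%:Z & ~~ chi w \/ pushed eta chi j w].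
Proof.
have fwd n : forall e z, arrow_upto n e z -> exists w : int, [/\ w < z, eta w,
     (forall v : int, w < v < z -> ~~ eta v),
     z + e%:Z <= w + (j w)%:Z & ~~ chi w \/ pushed eta chi j w].
  elim: n => [//|n IH] {}e {}z /=; case: ifPn => [ez /andP[h hj]|/[swap] /IH].
    exists (z - 1); split => //; [lia|move=> v; lia|lia|].
    case/orP: h => [->|/IH[w [wz ew vw zw]]]; first by left.
    move=> h; right; case: h => [h|[m h]].
      by exists 1; exists w; split => //; [lia|left].
    by exists m.+1; exists w; split => //; [lia|right].
  move=> [w [wz ew vw zw h]] ez; exists w; split => //; [lia| |lia].
  move=> v hv; have [->|ne] := eqVneq v (z - 1); first exact: ez.
  by apply: vw; move/eqP: ne; lia.
split; first by move=> /asboolP[n /fwd].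
(* an arrow leaving [w] is carried over the empty sites between [w] and [z] *)
have carry (w : int) (d : nat) : eta w -> ~~ chi w \/ arrow 0 w ->
    forall e, (forall v : int, w < v < w + d.+1%:Z -> ~~ eta v) ->
    (d + e < j w)%N -> arrow e (w + d.+1%:Z).
  move=> ew dep; elim: d => [|d IH] {}e vw lt.
    by rewrite arrowS ew lt andbT; case: dep => -> //; rewrite orbT.
  rewrite -addn1 PoszD addrA arrowS (negbTE (vw _ _)); last lia.
  by apply: IH => [v hv|]; [apply: vw; lia|lia].
have upto n : forall z, pushed_upto eta chi j n z -> arrow 0 z.
  elim: n => [//|n IH] {}z /= [w [wz ew vw zw h]].
  have [d dE] : exists d : nat, z = w + d.+1%:Z by exists (absz (z - w - 1)%R); lia.
  rewrite dE in vw zw *; apply: carry => //; last lia.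
  by case: h => [|/IH]; [left|right].
move=> [w [wz ew vw zw h]].
have [d dE] : exists d : nat, z = w + d.+1%:Z by exists (absz (z - w - 1)%R); lia.
rewrite dE in vw zw *; apply: carry => //; last lia.
by case: h => [|[n /upto]]; [left|right].
Qed.

Lemma arrow0_pushed z : arrow 0 z <-> pushed eta chi j z.
Proof.
rewrite arrow_pushedP; split => [[w [wz ew vw zw [h|[m h]]]]|[[//|n] /= [w [wz ew vw zw h]]]].
- by exists 1; exists w; split => //; [lia|left].
- by exists m.+1; exists w; split => //; [lia|right].
- exists w; split => //; first lia.
  by case: h => [|h]; [left|right; exists n].
Qed.

(** An arrow reaching an occupied site ends there and replaces the particle it pushes out; at an
    empty site it ends exactly when it does not reach one site further, hence [arrow 1]. *)
Lemma sv_stepE y :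
  sv_step eta chi j y =
  if eta y then arrow 0 y || chi y else arrow 0 y && ~~ arrow 1 y.
Proof.
have reachP : (exists w, reaches eta chi j w y) <-> arrow 0 y.
  rewrite arrow_pushedP; split => [[w [wz [ew h] vw zw]]|[w [wz ew vw zw h]]]; exists w.
    by split => //; lia.
  by split => //; lia.
apply/asboolP/idP => [[[ey nd]|[w [r h]]]|].
- rewrite ey; apply/orP; right; apply: contrapT => /negP nc; apply: nd.
  by split => //; left.
- have a0 : arrow 0 y by apply/reachP; exists w.
  rewrite a0; case ey: (eta y) => //=; apply/negP => /arrow_pushedP[w' [w'y ew' vw' zw' _]].
  case: h => [|yw]; first by rewrite ey.
  case: r => wy [ew _] vw _.
  have ww : w = w'.
    have [lt|lt|//] := ltgtP w w'.
      by have := vw w'; rewrite ew' lt w'y => /(_ isT).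
    by have := vw' w; rewrite ew lt wy => /(_ isT).
  by subst w'; lia.
- case ey: (eta y).
    have [a0 _|/negbTE a0] := boolP (arrow 0 y).
      by right; move/reachP: a0 => [w r]; exists w; split => //; left.
    move=> /= cy; left; split => // -[_]; rewrite cy -arrow0_pushed a0; by case.
  move=> /andP[/[dup] a0 /arrow_pushedP[w [wz ew vw zw h]] na1]; right; exists w.
  split; first by split => //; lia.
  right; apply/eqP; rewrite eq_le; apply/andP; split; first lia.
  rewrite leNgt; apply/negP => lt; move/negP: na1; apply; apply/arrow_pushedP.
  by exists w; split => //; lia.
Qed.

End OneStepPath.

(** * Boolean events *)

Section BooleanEvents.
Context {R : realType} {d : measure_display} {T : measurableType d}.
Variable P : probability T R.

(** Boolean events and real probabilities turn set algebra into case analysis and bring sums of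
    probabilities within reach of [ring] and [lra]. *)
Definition event (f : T -> bool) : Prop := measurable [set w | f w].
Definition Pr (f : T -> bool) : R := fine (P [set w | f w]).

Lemma eq_event f g : f =1 g -> event f -> event g.
Proof. by move=> /funext ->. Qed.

Lemma eq_Pr f g : f =1 g -> Pr f = Pr g.
Proof. by move=> /funext ->. Qed.

Lemma event_cst c : event (fun=> c).
Proof.
case: c; rewrite /event.
  by rewrite (_ : [set _ | _] = setT); [exact: measurableT|apply/seteqP; split].
by rewrite (_ : [set _ | _] = set0); [exact: measurable0|apply/seteqP; split].
Qed.

Lemma event_and f g : event f -> event g -> event (fun w => f w && g w).
Proof.
move=> mf mg; rewrite /event (_ : [set _ | _] = [set w | f w] `&` [set w | g w]).
  exact: measurableI.
by apply/seteqP; split=> [w /= /andP //|w /= [-> ->] //].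
Qed.

Lemma event_not f : event f -> event (fun w => ~~ f w).
Proof.
move=> mf; rewrite /event (_ : [set _ | _] = ~` [set w | f w]).
  exact: measurableC.
by apply/seteqP; split=> w /= /negP.
Qed.

Lemma event_or f g : event f -> event g -> event (fun w => f w || g w).
Proof.
move=> mf mg; apply: (@eq_event (fun w => ~~ (~~ f w && ~~ g w))).
  by move=> w; rewrite negb_and !negbK.
by apply/event_not/event_and; apply/event_not.
Qed.

Lemma event_if f g h : event f -> event g -> event h ->
  event (fun w => if f w then g w else h w).
Proof.
move=> mf mg mh; apply: (@eq_event (fun w => f w && g w || ~~ f w && h w)).
  by move=> w; case: (f w); case: (g w); case: (h w).
by apply: event_or; apply: event_and => //; exact: event_not.
Qed.

Lemma event_eqb f c : event f -> event (fun w => f w == c).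
Proof.
move=> mf; case: c; first by apply: eq_event mf => w; rewrite eqb_id.
by apply: eq_event (event_not mf) => w; rewrite eqbF_neg.
Qed.

Lemma event_exists (g : nat -> T -> bool) :
  (forall n, event (g n)) -> event (fun w => `[< exists n, g n w >]).
Proof.
move=> mg; rewrite /event (_ : [set _ | _] = \bigcup_n [set w | g n w]).
  by apply: bigcupT_measurable => n; exact: mg.
by apply/seteqP; split=> [w /= /asboolP[n]|w /= [n _ gn]]; [exists n|apply/asboolP; exists n].
Qed.

Lemma PrE f : event f -> P [set w | f w] = (Pr f)%:E.
Proof. by move=> mf; rewrite /Pr fineK // fin_num_measure. Qed.

Lemma Pr_ge0 f : 0 <= Pr f.
Proof. exact/fine_ge0/measure_ge0. Qed.

Lemma Pr_true : Pr (fun=> true) = 1.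
Proof.
rewrite /Pr (_ : [set _ | _] = setT) ?probability_setT //.
by apply/seteqP; split.
Qed.

Lemma Pr_false : Pr (fun=> false) = 0.
Proof.
rewrite /Pr (_ : [set _ | _] = set0) ?measure0 //.
by apply/seteqP; split.
Qed.

Lemma Pr_add f g h : event f -> event g -> (forall w, h w = f w || g w) ->
  (forall w, f w -> g w -> False) -> Pr h = Pr f + Pr g.
Proof.
move=> mf mg hE fg; apply: EFin_inj; rewrite EFinD -!PrE //; last first.
  by apply: eq_event (event_or mf mg) => w; rewrite hE.
rewrite (_ : [set w | h w] = [set w | f w] `|` [set w | g w]); last first.
  by apply/seteqP; split=> w /=; rewrite hE => /orP.
rewrite measureU //; apply/seteqP; split=> w //= [fw gw]; exact: fg fw gw.
Qed.

Lemma Pr_split g f : event f -> event g ->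
  Pr f = Pr (fun w => f w && g w) + Pr (fun w => f w && ~~ g w).
Proof.
move=> mf mg; apply: Pr_add; try by apply: event_and => //; exact: event_not.
- by move=> w; case: (f w); case: (g w).
- by move=> w; case: (f w); case: (g w).
Qed.

Lemma Pr_le f g : event f -> event g -> (forall w, f w -> g w) -> Pr f <= Pr g.
Proof.
move=> mf mg fg; rewrite -lee_fin -!PrE // le_measure ?inE //=.
Qed.

Lemma Pr_sum (I : finType) (F : I -> T -> bool) f :
  event f -> (forall i, event (F i)) -> (forall w, exists i, F i w) ->
  (forall i k w, F i w -> F k w -> i = k) ->
  Pr f = \sum_i Pr (fun w => f w && F i w).
Proof.
move=> mf mF ex un; have -> : Pr f = Pr (fun w => f w && has (F^~ w) (index_enum I)).
  apply: eq_Pr => w; have [i iw] := ex w.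
  by rewrite (_ : has _ _ = true) ?andbT //; apply/hasP; exists i; rewrite ?mem_index_enum.
have := index_enum_uniq I; elim: (index_enum I) => [_|i s IH /= /andP[nis us]].
  by rewrite big_nil -Pr_false; apply: eq_Pr => w; rewrite andbF.
rewrite big_cons -IH //; apply: Pr_add.
- exact: event_and.
- apply: event_and => //; elim: (s) => [|k s' IHs] /=; first exact: event_cst.
  exact: event_or.
- by move=> w; rewrite andb_orr.
- move=> w /andP[_ Fi] /andP[_ /hasP[k ks Fk]].
  by move: nis; rewrite (un _ _ _ Fi Fk) ks.
Qed.

Lemma Pr_cvg (g : nat -> T -> bool) f : event f -> (forall n, event (g n)) ->
  (forall m n w, (m <= n)%N -> g m w -> g n w) ->
  (fun n => Pr (fun w => f w && g n w)) @ \oo -->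
    Pr (fun w => f w && `[< exists n, g n w >]).
Proof.
move=> mf mg nd; have mfg n := event_and mf (mg n).
have E : [set w | f w && `[< exists n, g n w >]] = \bigcup_n [set w | f w && g n w].
  apply/seteqP; split=> [w /= /andP[fw /asboolP[n gn]]|w /= [n _ /andP[fw gn]]].
    by exists n => //=; rewrite fw.
  by rewrite fw; apply/asboolP; exists n.
apply: fine_cvg; rewrite /Pr E fineK; last by rewrite fin_num_measure //; exact: bigcupT_measurable.
apply: nondecreasing_cvg_mu => //; first exact: bigcupT_measurable.
move=> m n mn; apply/subsetPset => w /= /andP[-> gw] /=.
exact: nd gw.
Qed.

End BooleanEvents.

#[global] Hint Resolve event_cst : core.

Ltac event_tac := repeat first
  [ assumption
  | match goal with
    | |- event (fun _ => true) => exact: event_cst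
    | |- event (fun _ => false) => exact: event_cst
    | |- event (fun w => ~~ _) => apply: event_not
    | |- event (fun w => _ && _) => apply: event_and
    | |- event (fun w => _ || _) => apply: event_or
    | |- event (fun w => _ == _) => apply: event_eqb
    end ].

(** * The law of one step *)

Definition upd (u : int -> bool) (x : int) (c : bool) : int -> bool :=
  fun y => if y == x then c else u y.

(** The values of [u] outside the window do not matter; patterns on different windows thus share one
    type, and [upd] prescribes a single site. *)
Definition agree (a b : int) (eta u : int -> bool) : bool :=
  `[< forall y, a <= y < b -> eta y = u y >].

Lemma agree_recl a b eta u : a < b ->
  agree a b eta u = (eta a == u a) && agree (a + 1) b eta u.
Proof.
move=> ab; apply/asboolP/andP => [h|[/eqP h /asboolP h'] y /andP[ay yb]].
  split; first by apply/eqP/h; rewrite lexx.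
  by apply/asboolP => y yb; apply: h; lia.
have [->//|ne] := eqVneq y a; apply: h'; move/eqP: ne; lia.
Qed.

Lemma agree_recr a b eta u : a <= b ->
  agree a (b + 1) eta u = agree a b eta u && (eta b == u b).
Proof.
move=> ab; apply/asboolP/andP => [h|[/asboolP h' /eqP h] y /andP[ay yb]].
  split; last by apply/eqP/h; lia.
  by apply/asboolP => y yb; apply: h; lia.
have [->//|ne] := eqVneq y b; apply: h'; move/eqP: ne; lia.
Qed.

Lemma agree_nil a eta u : agree a a eta u = true.
Proof. by apply/asboolP => y; lia. Qed.

Lemma eq_agree a b eta u u' : (forall y, a <= y < b -> u y = u' y) ->
  agree a b eta u = agree a b eta u'.
Proof.
by move=> h; apply/asboolP/asboolP => h' y yb; [rewrite -h|rewrite h] => //; exact: h'.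
Qed.

Lemma agree_updl a b eta u x c : x < a -> agree a b eta (upd u x c) = agree a b eta u.
Proof.
move=> xa; apply: eq_agree => y yb; rewrite /upd; case: eqP => // yx; lia.
Qed.

Lemma agree_updr a b eta u x c : b <= x -> agree a b eta (upd u x c) = agree a b eta u.
Proof.
move=> xa; apply: eq_agree => y yb; rewrite /upd; case: eqP => // yx; lia.
Qed.

Lemma agree_upd a b eta u c : a < b ->
  agree a b eta (upd u a c) = (eta a == c) && agree (a + 1) b eta u.
Proof. by move=> ab; rewrite agree_recl // agree_updl /upd ?eqxx //; lia. Qed.

Lemma event_agree (d : measure_display) (T : measurableType d)
    (f : T -> int -> bool) (a b : int) u :
  (forall x, event (fun w => f w x)) -> event (fun w => agree a b (f w) u).
Proof.
move=> mf; have [ab|ba] := leP b a.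
  apply: eq_event (event_cst true) => w; apply/esym/asboolP => y; lia.
have -> : b = a + (absz (b - a)%R)%:Z by lia.
elim: (absz _) => [|n IH]; first by apply: eq_event (event_cst true) => w; rewrite addr0 agree_nil.
apply: eq_event (event_and IH (event_eqb (u (a + n%:Z)) (mf (a + n%:Z)))) => w.
by rewrite -addn1 PoszD addrA agree_recr //; lia.
Qed.

Section OneStepModel.
Context {R : realType} {d : measure_display} {T : measurableType d}.
Variables (P : probability T R) (b1 b2 : R).
Variables (v : T -> int -> bool) (chi : int -> T -> bool) (j : int -> T -> nat).
Local Notation Pr := (Pr P).

(** Product events on consecutive sites. They are stable under absorbing the noise of one more site,
    which is what the inductions below do. *)
Fixpoint noise (l : seq (pred bool * pred nat)) (x : int) (w : T) : bool :=
  if l is (B, C) :: l' then [&& B (chi x w), C (j x w) & noise l' (x + 1) w]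
  else true.

(* [A] is an event which, together with the pattern of [v] on [x, b), is
   independent of the noise of the step at the sites to the right of [x]. *)
Record one_step (A : T -> bool) (b : int) : Prop := OneStep {
  event_init : forall x, event (fun w => v w x);
  event_chi : forall x, event (chi x);
  event_j : forall x (C : pred nat), event (fun w => C (j x w));
  event_base : event A;
  Pr_chi : forall x, Pr (chi x) = b1;
  Pr_j : forall x e, Pr (fun w => (e < j x w)%N) = b2 ^+ e;
  Pr_noise : forall x B C l, Pr (noise ((B, C) :: l) x) =
    Pr (fun w => B (chi x w)) * Pr (fun w => C (j x w)) * Pr (noise l (x + 1));
  Pr_base : forall x u l, Pr (fun w => A w && agree x b (v w) u && noise l x w) =
    Pr (fun w => A w && agree x b (v w) u) * Pr (noise l x) }.

Definition arr_upto n e x (w : T) := arrow_upto (v w) (chi^~ w) (j^~ w) n e x.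
Definition arr e x (w : T) := arrow (v w) (chi^~ w) (j^~ w) e x.
Definition next x (w : T) : bool := sv_step (v w) (chi^~ w) (j^~ w) x.

Section Theory.
Variables (A : T -> bool) (b : int).
Hypothesis M : one_step A b.

Lemma event_chi_pred x (B : pred bool) : event (fun w => B (chi x w)).
Proof.
case Bt: (B true); case Bf: (B false).
- by apply: eq_event (event_cst true) => w; case: (chi x w); rewrite ?Bt ?Bf.
- by apply: eq_event (event_chi M x) => w; case: (chi x w); rewrite ?Bt ?Bf.
- by apply: eq_event (event_not (event_chi M x)) => w; case: (chi x w); rewrite ?Bt ?Bf.
- by apply: eq_event (event_cst false) => w; case: (chi x w); rewrite ?Bt ?Bf.
Qed.

Lemma event_noise l x : event (noise l x).
Proof.
elim: l x => [|[B C] l IH] x /=; first exact: event_cst.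
by apply: event_and; [exact: event_chi_pred|apply: event_and; [exact: event_j M _ _|]].
Qed.

Lemma event_arr_upto n e x : event (arr_upto n e x).
Proof.
elim: n e x => [|n IH] e x; first exact: event_cst.
apply: event_if; [exact: event_init M _| |exact: IH].
apply: event_and; last exact: (event_j M _ (fun k => (e < k)%N)).
by apply: event_or; [apply: event_not; exact: event_chi M _|exact: IH].
Qed.

Lemma event_arr e x : event (arr e x).
Proof. by apply: event_exists => n; exact: event_arr_upto. Qed.

Lemma event_next x : event (next x).
Proof.
apply: eq_event; first by move=> w; apply/esym/sv_stepE.
apply: event_if; [exact: event_init M _| |].
  by apply: event_or; [exact: event_arr|exact: event_chi M _].
by apply: event_and; [|apply: event_not]; exact: event_arr.
Qed.

Lemma event_pat x u : event (fun w => A w && agree x b (v w) u).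
Proof. by apply: event_and; [exact: event_base M|apply: event_agree; exact: event_init M]. Qed.

Ltac ev := event_tac; first
  [ exact: event_base M | exact: event_init M _ | exact: event_chi M _
  | exact: event_noise | exact: event_arr_upto | exact: event_arr | exact: event_next
  | by apply: event_agree; exact: event_init M ].

Lemma Pr_noise_chi_j (B : pred bool) e l x :
  Pr (noise ((B, fun k => (e < k)%N) :: l) x) =
  Pr (fun w => B (chi x w)) * b2 ^+ e * Pr (noise l (x + 1)).
Proof. by rewrite (Pr_noise M) (Pr_j M). Qed.

Lemma Pr_chi_neg x : Pr (fun w => negb (chi x w)) = 1 - b1.
Proof.
have := Pr_split P (event_cst true) (event_chi M x); rewrite Pr_true /= (Pr_chi M) => ->.
by rewrite addrC addKr.
Qed.

(** Lack of memory of the geometric law: given the pattern and an arrow reaching [x], the arrow goes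
    [e] sites further with probability [b2 ^+ e], independently of the noise from [x] on. The fuel
    serves the induction and is removed in [arr_memoryless]. *)
Definition upto_memoryless n := forall (x : int) u e l, x <= b ->
  Pr (fun w => A w && agree x b (v w) u && arr_upto n e x w && noise l x w) =
  Pr (fun w => A w && agree x b (v w) u && arr_upto n 0 x w) * b2 ^+ e * Pr (noise l x).

(** Case distinction on the site [x - 1]: if occupied, it emits an arrow when [chi] vanishes (weight
    [1 - b1]) or, failing this, when an arrow arrives (weight [b1]); if empty, an arrow passes on
    with weight [b2]. *)
Lemma Pr_arr_uptoS n (x : int) u e l : upto_memoryless n -> x <= b ->
  let pat c w := A w && agree (x - 1) b (v w) (upd u (x - 1) c) in
  Pr (fun w => A w && agree x b (v w) u && arr_upto n.+1 e x w && noise l x w) =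
  (Pr (pat true) * (1 - b1) + Pr (fun w => pat true w && arr_upto n 0 (x - 1) w) * b1
   + Pr (fun w => pat false w && arr_upto n 0 (x - 1) w) * b2) * b2 ^+ e * Pr (noise l x).
Proof.
move=> IH xb pat.
have patE c w : pat c w = A w && ((v w (x - 1) == c) && agree x b (v w) u).
  by rewrite /pat agree_upd ?subrK //; lia.
have mpat c : event (pat c) by exact: event_pat.
have mv := event_init M (x - 1).
have marr := event_arr_upto n 0 (x - 1).
have mnoise := event_noise.
rewrite (Pr_split P (g := fun w => v w (x - 1))) //; last first.
  by ev.
pose N B := noise ((B, fun k => (e < k)%N) :: l) (x - 1).
have NE B : N B =1 fun w => [&& B (chi (x - 1) w), (e < j (x - 1) w)%N & noise l x w].
  by move=> w; rewrite /N /= subrK.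
have PN B : Pr (N B) = Pr (fun w => B (chi (x - 1) w)) * b2 ^+ e * Pr (noise l x).
  by rewrite Pr_noise_chi_j subrK.
have xb' : x - 1 <= b by lia.
have mN B : event (N B) by exact: event_noise.
(* Inclusion-exclusion for a departure by [~~ chi] or by an incoming arrow: [IH] covers events that
   contain the arrow, not those that exclude it. *)
rewrite [X in X + _](_ : _ =
    Pr (fun w => pat true w && arr_upto n 0 (x - 1) w && N predT w) +
    (Pr (fun w => pat true w && N negb w)
     - Pr (fun w => pat true w && arr_upto n 0 (x - 1) w && N negb w))); last first.
  rewrite [X in _ + (X - _)](Pr_split P (g := arr_upto n 0 (x - 1))) //; last first.
    by event_tac; [exact: mpat|exact: mN].
  rewrite [X in _ + (X + _ - _)](_ : _ =
     Pr (fun w => pat true w && arr_upto n 0 (x - 1) w && N negb w)); last first.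
    by apply: eq_Pr => w; rewrite andbAC.
  rewrite [X in _ = _ + X]addrAC subrr add0r.
  apply: Pr_add; try by event_tac; first [exact: mpat|exact: mN].
    move=> w; rewrite !NE !patE /arr_upto /=.
    case: (v w _); case: (chi _ _) => /=; case: (A w); case: (agree _ _ _ _);
      case: (arrow_upto _ _ _ _ _ _); case: (e < _)%N; by case: noise.
  by move=> w; case: (pat true w); case: (arr_upto _ _ _ _); rewrite /= ?andbF.
(* Vacuous noise is inserted at [x - 1], since [IH] at that site speaks of noise starting there. *)
rewrite [X in _ + X](_ : _ =
    Pr (fun w => pat false w && arr_upto n e.+1 (x - 1) w && noise ((predT : pred bool, predT : pred nat) :: l) (x - 1) w)); last first.
  apply: eq_Pr => w; rewrite !patE /= subrK /arr_upto /=.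
  by case: (v w _); case: (A w); case: (agree _ _ _ _) => //=; rewrite ?andbF ?andbT.
rewrite !IH // (Pr_base M) !PN (Pr_noise M) !Pr_true Pr_chi_neg subrK.
rewrite expr0 exprS; set q1 := Pr _; set q2 := Pr _; set q3 := Pr _; set q4 := Pr _.
rewrite /=; ring.
Qed.

Lemma arr_upto_memoryless n : upto_memoryless n.
Proof.
elim: n => [|n IH] x u e l xb.
  rewrite [X in X * _ * _](_ : _ = 0) ?mul0r.
    by rewrite -(Pr_false P); apply: eq_Pr => w; rewrite /arr_upto /= andbF.
  by rewrite -(Pr_false P); apply: eq_Pr => w; rewrite /arr_upto /= andbF.
rewrite Pr_arr_uptoS //.
have /esym := @Pr_arr_uptoS n x u 0 [::] IH xb; rewrite /= Pr_true expr0 !mulr1 => ->.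
by congr (_ * _ * _); apply: eq_Pr => w; rewrite andbT.
Qed.

Lemma Pr_arr_cvg f e x : event f ->
  (fun n => Pr (fun w => f w && arr_upto n e x w)) @ \oo --> Pr (fun w => f w && arr e x w).
Proof.
move=> mf; apply: Pr_cvg => //; first by move=> n; exact: event_arr_upto.
by move=> m n w; exact: arrow_upto_le.
Qed.

Lemma arr_memoryless (x : int) u e l : x <= b ->
  Pr (fun w => A w && agree x b (v w) u && arr e x w && noise l x w) =
  Pr (fun w => A w && agree x b (v w) u && arr 0 x w) * b2 ^+ e * Pr (noise l x).
Proof.
move=> xb; pose f w := A w && agree x b (v w) u && noise l x w.
have mf : event f by apply: event_and; [exact: event_pat|exact: event_noise].
transitivity (Pr (fun w => f w && arr e x w)).
  by apply: eq_Pr => w; rewrite /f andbAC.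
have c1 := Pr_arr_cvg (e := e) (x := x) mf.
have c2 : (fun n => Pr (fun w => f w && arr_upto n e x w)) @ \oo -->
    Pr (fun w => A w && agree x b (v w) u && arr 0 x w) * b2 ^+ e * Pr (noise l x).
  rewrite (_ : (fun n => _) = fun n => Pr (fun w => A w && agree x b (v w) u && arr_upto n 0 x w)
      * b2 ^+ e * Pr (noise l x)); last first.
    apply/funext => n; rewrite -arr_upto_memoryless //.
    by apply: eq_Pr => w; rewrite /f andbAC.
  by do 2 apply: cvgMl; apply: Pr_arr_cvg; exact: event_pat.
exact: cvg_unique c1 c2.
Qed.

End Theory.
End OneStepModel.

Lemma arrow_pred eta chi j e x : arrow eta chi j e.+1 x -> arrow eta chi j e x.
Proof.
move=> /arrow_pushedP[w [wz ew vw zw h]]; apply/arrow_pushedP.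
by exists w; split => //; lia.
Qed.

Lemma arrow_le eta chi j m n x : (m <= n)%N -> arrow eta chi j n x -> arrow eta chi j m x.
Proof.
by move=> /subnK <-; elim: (n - m)%N => // k IH /arrow_pred; exact: IH.
Qed.

Lemma upd_id u x : upd u x (u x) = u.
Proof. by apply/funext => y; rewrite /upd; case: eqP => [->|]. Qed.

(** * The six-vertex transition kernel at a site *)

Section Vertex.
Context {R : realType} {d : measure_display} {T : measurableType d}.
Variables (P : probability T R) (b1 b2 : R).
Variables (v : T -> int -> bool) (chi : int -> T -> bool) (j : int -> T -> nat).
Variables (A : T -> bool) (b : int).
Hypothesis M : one_step P b1 b2 v chi j A b.
Local Notation Pr := (Pr P).
Local Notation arr := (arr v chi j).
Local Notation next := (next v chi j).
Local Notation noise := (noise chi j).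
Local Notation Tb := (predT : pred bool).
Local Notation Tn := (predT : pred nat).
Local Notation gtn_ e := ((fun k => e < k)%N : pred nat).

(** The invariant carried from left to right: [E], which may involve new particles left of [x], is
    independent of the noise from [x] on, and the arrow at [x] is memoryless jointly with [E]. *)
Record adapted (x : int) (E : T -> bool) : Prop := Adapted {
  adapted_event : event E;
  adapted_noise : forall l, Pr (fun w => E w && noise l x w) = Pr E * Pr (noise l x);
  adapted_arr : forall e l, Pr (fun w => E w && arr e x w && noise l x w) =
    Pr (fun w => E w && arr 0 x w) * b2 ^+ e * Pr (noise l x) }.

Section Next.
Variables (x : int) (E : T -> bool).
Let E1 w := E w && v w x.
Let E0 w := E w && ~~ v w x.
Hypotheses (mE : event E) (aE1 : adapted x E1) (aE0 : adapted x E0).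

Let mE1 : event E1 := adapted_event aE1.
Let mE0 : event E0 := adapted_event aE0.
Let mnoise l y : event (noise l y) := event_noise M l y.
Let marr e y : event (arr e y) := event_arr M e y.
Let mchi y : event (chi y) := event_chi M y.
Let mnext y : event (next y) := event_next M y.
Let mj y e : event (fun w => (e < j y w)%N) := event_j M y (fun k => (e < k)%N).
Let mv y : event (fun w => v w y) := event_init M y.

Ltac ev4 := event_tac; first [exact: mnoise|exact: marr|exact: mchi|exact: mnext|exact: mj|exact: mv].

Let Pr_noise0 C l : Pr (noise ((Tb, C) :: l) x) = Pr (fun w => C (j x w)) * Pr (noise l (x + 1)).
Proof. by rewrite (Pr_noise M) Pr_true mul1r. Qed.

Let Pr_noiseN C l : Pr (noise ((negb, C) :: l) x) =
  (1 - b1) * Pr (fun w => C (j x w)) * Pr (noise l (x + 1)).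
Proof. by rewrite (Pr_noise M) (Pr_chi_neg M). Qed.

Let nextE w : next x w = if v w x then arr 0 x w || chi x w else arr 0 x w && ~~ arr 1 x w.
Proof. exact: sv_stepE. Qed.

Let arrSE e w : arr e (x + 1) w =
  if v w x then (~~ chi x w || arr 0 x w) && (e < j x w)%N else arr e.+1 x w.
Proof. exact: arrowS. Qed.

(** A new particle together with an outgoing arrow needs an old particle and an incoming arrow, as
    an arrow ending at an empty site goes no further. A hole with an outgoing arrow arises from a
    particle leaving unpushed, or from an arrow crossing an empty site. *)
Let Pr_next_arr c e l :
  Pr (fun w => E w && (next x w == c) && arr e (x + 1) w && noise l (x + 1) w) =
  (if c then Pr (fun w => E1 w && arr 0 x w)
   else (Pr E1 - Pr (fun w => E1 w && arr 0 x w)) * (1 - b1)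
        + Pr (fun w => E0 w && arr 0 x w) * b2) * b2 ^+ e * Pr (noise l (x + 1)).
Proof.
have a1 w k : arr k.+1 x w -> arr 1 x w by apply: arrow_le.
have a0 w k : arr k.+1 x w -> arr 0 x w by apply: arrow_le.
case: c.
  transitivity (Pr (fun w => E1 w && arr 0 x w && noise ((Tb, gtn_ e) :: l) x w)).
    apply: eq_Pr => w; rewrite nextE arrSE /E1 /= eqb_id.
    case: (v w x); case: (E w) => //=; rewrite ?andbF //=.
      by case: (arr 0 x w) => //=; rewrite ?orbT ?andbF //; case: (chi x w).
    by have := a1 w e; case: (arr e.+1 x w) => /= [->//|_]; rewrite ?andbF.
  by rewrite (adapted_arr aE1) expr0 mulr1 Pr_noise0 (Pr_j M) mulrA.
transitivity (
    (Pr (fun w => E1 w && noise ((negb, gtn_ e) :: l) x w)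
     - Pr (fun w => E1 w && arr 0 x w && noise ((negb, gtn_ e) :: l) x w))
    + Pr (fun w => E0 w && arr e.+1 x w && noise ((Tb, Tn) :: l) x w)); last first.
  rewrite (adapted_noise aE1) !adapted_arr // Pr_noiseN Pr_noise0 Pr_true (Pr_j M).
  by rewrite expr0 exprS; ring.
rewrite [X in X - _](Pr_split P (g := arr 0 x)); [|by ev4|by ev4].
rewrite [X in X + _ - _](_ : _ =
   Pr (fun w => E1 w && arr 0 x w && noise ((negb, gtn_ e) :: l) x w)); last first.
  by apply: eq_Pr => w; rewrite andbAC.
rewrite [X in _ = X + _]addrAC subrr add0r; apply: Pr_add; try by ev4.
  move=> w; rewrite nextE arrSE /E1 /E0 /= eqbF_neg.
  have := a1 w e; have := a0 w e.
  case: (v w x); case: (E w) => //=; rewrite ?andbF ?andbT ?orbF //=.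
    by case: (arr 0 x w); case: (chi x w) => //= _ _; rewrite ?andbF ?andbT //.
  by case: (arr e.+1 x w) => /= [-> // -> //|_ _]; rewrite ?andbF.
by move=> w; rewrite /E1 /E0; case: (v w x); rewrite /= ?andbF.
Qed.

Let Pr_next_noise c l :
  Pr (fun w => E w && (next x w == c) && noise l (x + 1) w) =
  (if c then Pr (fun w => E1 w && arr 0 x w) + (Pr E1 - Pr (fun w => E1 w && arr 0 x w)) * b1
             + Pr (fun w => E0 w && arr 0 x w) * (1 - b2)
   else (Pr E1 - Pr (fun w => E1 w && arr 0 x w)) * (1 - b1)
        + (Pr E0 - Pr (fun w => E0 w && arr 0 x w) * (1 - b2))) * Pr (noise l (x + 1)).
Proof.
(* Only two events change the occupation of [x]: an unpushed particle leaves ([N1]), or an arrow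
   ends at an empty site ([N0]). Each is a difference of two events whose probabilities factor. *)
pose N1 w := E1 w && ~~ arr 0 x w && ~~ chi x w && noise l (x + 1) w.
have PN1 : Pr N1 = (Pr E1 - Pr (fun w => E1 w && arr 0 x w)) * (1 - b1) * Pr (noise l (x + 1)).
  transitivity (Pr (fun w => E1 w && noise ((negb, Tn) :: l) x w)
     - Pr (fun w => E1 w && arr 0 x w && noise ((negb, Tn) :: l) x w)); last first.
    rewrite (adapted_noise aE1) (adapted_arr aE1) Pr_noiseN Pr_true expr0; ring.
  rewrite [X in X - _](Pr_split P (g := arr 0 x)); [|by ev4|by ev4].
  rewrite [X in _ = X + _ - _](_ : _ =
     Pr (fun w => E1 w && arr 0 x w && noise ((negb, Tn) :: l) x w)); last first.
    by apply: eq_Pr => w; rewrite andbAC.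
  rewrite addrAC subrr add0r; apply: eq_Pr => w; rewrite /N1 /=.
  by case: (E1 w); case: (arr 0 x w); case: (chi x w) => //=; rewrite ?andbF ?andbT.
pose N0 w := E0 w && arr 0 x w && ~~ arr 1 x w && noise l (x + 1) w.
have PN0 : Pr N0 = Pr (fun w => E0 w && arr 0 x w) * (1 - b2) * Pr (noise l (x + 1)).
  transitivity (Pr (fun w => E0 w && arr 0 x w && noise ((Tb, Tn) :: l) x w)
     - Pr (fun w => E0 w && arr 1 x w && noise ((Tb, Tn) :: l) x w)); last first.
    rewrite !(adapted_arr aE0) Pr_noise0 Pr_true expr0 expr1; ring.
  rewrite [X in X - _](Pr_split P (g := arr 1 x)); [|by ev4|by ev4].
  rewrite [X in _ = X + _ - _](_ : _ =
     Pr (fun w => E0 w && arr 1 x w && noise ((Tb, Tn) :: l) x w)); last first.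
    apply: eq_Pr => w; have : arr 1 x w -> arr 0 x w by apply: arrow_le.
    by case: (arr 1 x w) => [-> //|_]; rewrite ?andbT ?andbF.
  rewrite addrAC subrr add0r; apply: eq_Pr => w; rewrite /N0 /=.
  by case: (E0 w); case: (arr 0 x w); case: (arr 1 x w); rewrite /= ?andbF ?andbT.
have PE1 : Pr (fun w => E1 w && noise l (x + 1) w) = Pr E1 * Pr (noise l (x + 1)).
  have := adapted_noise aE1 ((Tb, Tn) :: l); rewrite Pr_noise0 Pr_true mul1r => <-.
  exact: eq_Pr.
have PE0 : Pr (fun w => E0 w && noise l (x + 1) w) = Pr E0 * Pr (noise l (x + 1)).
  have := adapted_noise aE0 ((Tb, Tn) :: l); rewrite Pr_noise0 Pr_true mul1r => <-.
  exact: eq_Pr.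
have mN1 : event N1 by rewrite /N1; ev4.
have mN0 : event N0 by rewrite /N0; ev4.
have S1 : Pr (fun w => E1 w && noise l (x + 1) w) =
    Pr N1 + Pr (fun w => E1 w && (arr 0 x w || chi x w) && noise l (x + 1) w).
  apply: Pr_add; try by ev4.
    by move=> w; rewrite /N1; case: (E1 w); case: (arr 0 x w); case: (chi x w) => //=; rewrite ?orbF.
  by move=> w; rewrite /N1; case: (E1 w); case: (arr 0 x w); case: (chi x w).
have S0 : Pr (fun w => E0 w && noise l (x + 1) w) =
    Pr N0 + Pr (fun w => E0 w && ~~ (arr 0 x w && ~~ arr 1 x w) && noise l (x + 1) w).
  apply: Pr_add; try by ev4.
    by move=> w; rewrite /N0; case: (E0 w); case: (arr 0 x w); case: (arr 1 x w) => //=; rewrite ?orbF.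
  by move=> w; rewrite /N0; case: (E0 w); case: (arr 0 x w); case: (arr 1 x w).
case: c.
  transitivity (Pr (fun w => E1 w && (arr 0 x w || chi x w) && noise l (x + 1) w) + Pr N0).
    apply: Pr_add; try by ev4.
      move=> w; rewrite nextE /N0 /E1 /E0 eqb_id.
      by case: (v w x); case: (E w) => //=; rewrite ?orbF ?andbF // andbA.
    by move=> w; rewrite /N0 /E1 /E0; case: (v w x); rewrite ?andbF.
  rewrite (canRL (addKr _) (esym S1)) PE1 PN1 PN0; ring.
transitivity (Pr N1 + Pr (fun w => E0 w && ~~ (arr 0 x w && ~~ arr 1 x w) && noise l (x + 1) w)).
  apply: Pr_add; try by ev4.
    move=> w; rewrite nextE /N1 /E1 /E0 eqbF_neg.
    case: (v w x); case: (E w) => //=; rewrite ?orbF ?andbF //.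
    by case: (arr 0 x w); case: (chi x w).
  by move=> w; rewrite /N1 /E1 /E0; case: (v w x); rewrite /= ?andbF.
rewrite (canRL (addKr _) (esym S0)) PE0 PN1 PN0; ring.
Qed.

(** In the two preceding formulas [e] and [l] enter only through [b2 ^+ e] and the probability of
    the noise; comparing with [e = 0] and empty noise gives the claim. *)
Lemma adapted_next c : adapted (x + 1) (fun w => E w && (next x w == c)).
Proof.
have n1 : Pr (noise [::] (x + 1)) = 1 by exact: Pr_true.
split; first by ev4.
  move=> l; rewrite Pr_next_noise; congr (_ * _).
  have := Pr_next_noise c [::]; rewrite n1 mulr1 => <-.
  by apply: eq_Pr => w; rewrite /= andbT.
move=> e l; rewrite Pr_next_arr; congr (_ * _ * _).
have := Pr_next_arr c 0 [::]; rewrite n1 expr0 !mulr1 => <-.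
by apply: eq_Pr => w; rewrite /= andbT.
Qed.

Lemma Pr_next_arr0 c : Pr (fun w => E w && (next x w == c) && arr 0 (x + 1) w) =
  if c then Pr (fun w => E1 w && arr 0 x w)
  else (Pr E1 - Pr (fun w => E1 w && arr 0 x w)) * (1 - b1)
       + Pr (fun w => E0 w && arr 0 x w) * b2.
Proof.
have n1 : Pr (noise [::] (x + 1)) = 1 by exact: Pr_true.
have := Pr_next_arr c 0 [::]; rewrite n1 expr0 !mulr1 => <-.
by apply: eq_Pr => w; rewrite /= andbT.
Qed.

Lemma Pr_next c : Pr (fun w => E w && (next x w == c)) =
  if c then Pr (fun w => E1 w && arr 0 x w) + (Pr E1 - Pr (fun w => E1 w && arr 0 x w)) * b1
            + Pr (fun w => E0 w && arr 0 x w) * (1 - b2)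
  else (Pr E1 - Pr (fun w => E1 w && arr 0 x w)) * (1 - b1)
       + (Pr E0 - Pr (fun w => E0 w && arr 0 x w) * (1 - b2)).
Proof.
have n1 : Pr (noise [::] (x + 1)) = 1 by exact: Pr_true.
have := Pr_next_noise c [::]; rewrite n1 !mulr1 => <-.
by apply: eq_Pr => w; rewrite /= andbT.
Qed.

End Next.

Variable a : int.

Definition mix (x : int) (u : int -> bool) (w : T) : bool :=
  A w && agree a x (next^~ w) u && agree x b (v w) u.

Definition Q (x : int) (u : int -> bool) (h : bool) : R :=
  Pr (fun w => mix x u w && (arr 0 x w == h)).

Lemma event_mix x u : event (mix x u).
Proof.
apply: event_and; last by apply: event_agree; exact: event_init M.
by apply: event_and; [exact: event_base M|apply: event_agree; exact: event_next M].
Qed.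

Definition off (x : int) (u : int -> bool) (w : T) : bool :=
  A w && agree a x (next^~ w) u && agree (x + 1) b (v w) u.

Lemma event_off x u : event (off x u).
Proof.
apply: event_and; last by apply: event_agree; exact: event_init M.
by apply: event_and; [exact: event_base M|apply: event_agree; exact: event_next M].
Qed.

Lemma mixE (x : int) u c w : a <= x < b -> mix x (upd u x c) w = off x u w && (v w x == c).
Proof.
move=> /andP[ax xb]; rewrite /mix agree_upd // agree_updr //.
by rewrite /off; case: (A w) => //=; case: (agree a x _ u) => //=; exact: andbC.
Qed.

Lemma mixSE (x : int) u c w : a <= x < b ->
  mix (x + 1) (upd u x c) w = off x u w && (next x w == c).
Proof.
move=> /andP[ax xb]; rewrite /mix agree_recr // agree_updr // agree_updl ?ltrDl //.
by rewrite /off /upd eqxx; case: (A w) => //=; case: (agree a x _ u) => //=; exact: andbC.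
Qed.

Lemma eq_adapted x E F : E =1 F -> adapted x E -> adapted x F.
Proof. by move=> /funext ->. Qed.

(** At [x = a] there are old particles only, and [arr_memoryless] applies; then they are replaced
    one at a time by [adapted_next]. *)
Lemma adapted_mix (x : int) u : a <= x <= b -> adapted x (mix x u).
Proof.
move=> /andP[ax xb]; move: (xb); have -> : x = a + (absz (x - a)%R)%:Z by lia.
elim: (absz _) u => [|n IH] u ab.
  rewrite addr0 in ab *.
  have mixa w : A w && agree a b (v w) u = mix a u w by rewrite /mix agree_nil andbT.
  apply: eq_adapted mixa _; split; first exact: event_pat M _ _.
    by move=> l; exact: Pr_base M _ _ _.
  by move=> e l; exact: (arr_memoryless M).
have nb : a <= a + n%:Z < b by lia.
rewrite -addn1 PoszD addrA.
apply: (@eq_adapted _ (fun w => off (a + n%:Z) u w && (next (a + n%:Z) w == u (a + n%:Z)))).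
  by move=> w; rewrite -mixSE // upd_id.
have nb' : a + n%:Z <= b by lia.
apply: adapted_next; first exact: event_off.
  by apply: eq_adapted (IH (upd u (a + n%:Z) true) nb') => w; rewrite mixE // eqb_id.
by apply: eq_adapted (IH (upd u (a + n%:Z) false) nb') => w; rewrite mixE // eqbF_neg.
Qed.

Lemma Q_sum x u : Pr (mix x u) = Q x u true + Q x u false.
Proof.
apply: Pr_add.
- by apply: event_and; [exact: event_mix|apply: event_eqb; exact: event_arr M _ _].
- by apply: event_and; [exact: event_mix|apply: event_eqb; exact: event_arr M _ _].
- by move=> w; case: (mix x u w); case: (arr 0 x w).
- by move=> w; case: (mix x u w); case: (arr 0 x w).
Qed.

Lemma Q_true x u : Q x u true = Pr (fun w => mix x u w && arr 0 x w).
Proof. by apply: eq_Pr => w; rewrite eqb_id. Qed.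

Lemma Q_false x u : Q x u false = Pr (mix x u) - Q x u true.
Proof. by rewrite Q_sum addrAC subrr add0r. Qed.

(* The transition of the six-vertex model at [x]: the pair (incoming vertical
   arrow, incoming horizontal arrow) turns into the pair of outgoing ones. *)
Lemma Q_step (x : int) u : a <= x < b ->
  let q c h := Q x (upd u x c) h in
  let q' c h := Q (x + 1) (upd u x c) h in
  [/\ q' true true = q true true, q' false false = q false false,
      q' false true = (1 - b1) * q true false + b2 * q false true &
      q' true false = b1 * q true false + (1 - b2) * q false true].
Proof.
move=> xab q q'; have xab' : a <= x <= b by lia.
pose E1 w := off x u w && v w x; pose E0 w := off x u w && ~~ v w x.
have E1E : mix x (upd u x true) =1 E1 by move=> w; rewrite mixE // eqb_id.
have E0E : mix x (upd u x false) =1 E0 by move=> w; rewrite mixE // eqbF_neg.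
have a1 : adapted x E1 by apply: eq_adapted E1E _; exact: adapted_mix.
have a0 : adapted x E0 by apply: eq_adapted E0E _; exact: adapted_mix.
have q1t : q true true = Pr (fun w => E1 w && arr 0 x w).
  by rewrite /q Q_true; apply: eq_Pr => w; rewrite E1E.
have q0t : q false true = Pr (fun w => E0 w && arr 0 x w).
  by rewrite /q Q_true; apply: eq_Pr => w; rewrite E0E.
have q1f : q true false = Pr E1 - Pr (fun w => E1 w && arr 0 x w).
  by rewrite -q1t /q Q_false; congr (_ - _); apply: eq_Pr.
have q0f : q false false = Pr E0 - Pr (fun w => E0 w && arr 0 x w).
  by rewrite -q0t /q Q_false; congr (_ - _); apply: eq_Pr.
have q't c : q' c true = Pr (fun w => off x u w && (next x w == c) && arr 0 (x + 1) w).
  by rewrite /q' Q_true; apply: eq_Pr => w; rewrite mixSE.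
have q'f c : q' c false = Pr (fun w => off x u w && (next x w == c)) - q' c true.
  by rewrite /q' Q_false; congr (_ - _); apply: eq_Pr => w; rewrite mixSE.
have q't1 := Pr_next_arr0 (E := off x u) a1 a0 true; have q't0 := Pr_next_arr0 (E := off x u) a1 a0 false.
have q's1 := Pr_next (E := off x u) a1 a0 true; have q's0 := Pr_next (E := off x u) a1 a0 false.
rewrite /= -/E1 -/E0 in q't1 q't0 q's1 q's0.
rewrite !q'f !q't q't1 q't0 q's1 q's0 q1t q0t q1f q0f.
by split; ring.
Qed.

End Vertex.

Definition transl (m : int) (u : int -> bool) : int -> bool := fun y => u (y - m).

Lemma transl_upd m u x c : transl m (upd u x c) = upd (transl m u) (x + m) c.
Proof. by apply/funext => y; rewrite /transl /upd subr_eq. Qed.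

(* The law of a step is determined, up to a factor, by that of the initial
   patterns on the windows [x, b): no sampling from the right of [b]. *)
Section Transfer.
Context {R : realType} {b1 b2 : R}.
Context {d : measure_display} {T : measurableType d} {P : probability T R}.
Context {v : T -> int -> bool} {chi : int -> T -> bool} {j : int -> T -> nat}.
Context {A : T -> bool} {b : int}.
Context {d' : measure_display} {T' : measurableType d'} {P' : probability T' R}.
Context {v' : T' -> int -> bool} {chi' : int -> T' -> bool} {j' : int -> T' -> nat}.
Context {A' : T' -> bool} {m : int}.
Hypothesis M : one_step P b1 b2 v chi j A b.
Hypothesis M' : one_step P' b1 b2 v' chi' j' A' (b + m).
Variable c : R.
Hypothesis same_init : forall x u, x <= b ->
  Pr P (fun w => A w && agree x b (v w) u) =
  c * Pr P' (fun w => A' w && agree (x + m) (b + m) (v' w) (transl m u)).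

(** [Pr_arr_uptoS] gives both sides the same linear recursion, with coefficients in [b1] and [b2]
    only, in terms of patterns one site longer on the left. *)
Lemma transfer_arr_upto n x u : x <= b ->
  Pr P (fun w => A w && agree x b (v w) u && arr_upto v chi j n 0 x w) =
  c * Pr P' (fun w => A' w && agree (x + m) (b + m) (v' w) (transl m u)
                      && arr_upto v' chi' j' n 0 (x + m) w).
Proof.
elim: n x u => [|n IH] x u xb.
  rewrite (eq_Pr P (g := fun=> false)); last by move=> w; rewrite /arr_upto /= andbF.
  rewrite (eq_Pr P' (g := fun=> false)); last by move=> w; rewrite /arr_upto /= andbF.
  by rewrite !Pr_false mulr0.
have xmb : x + m <= b + m by rewrite lerD2r.
have E (X : int) : X + m - 1 = X - 1 + m by rewrite addrAC.
have xb' : x - 1 <= b by lia.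
have L := Pr_arr_uptoS M u 0 [::] (@arr_upto_memoryless _ _ _ _ _ _ _ _ _ _ _ M n) xb.
have L' := Pr_arr_uptoS M' (transl m u) 0 [::] (@arr_upto_memoryless _ _ _ _ _ _ _ _ _ _ _ M' n) xmb.
cbv zeta in L, L'; rewrite (_ : Pr P (noise _ _ _ _) = 1) in L; last exact: Pr_true.
rewrite (_ : Pr P' (noise _ _ _ _) = 1) in L'; last exact: Pr_true.
rewrite expr0 !mulr1 in L; rewrite expr0 !mulr1 !E -!transl_upd in L'.
transitivity (Pr P (fun w => A w && agree x b (v w) u && arr_upto v chi j n.+1 0 x w
                             && noise chi j [::] x w)).
  by apply: eq_Pr => w; rewrite andbT.
rewrite L [X in _ = _ * X](eq_Pr P' (g := fun w =>
  A' w && agree (x + m) (b + m) (v' w) (transl m u)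
  && arr_upto v' chi' j' n.+1 0 (x + m) w && noise chi' j' [::] (x + m) w)); last first.
  by move=> w; rewrite andbT.
rewrite L' !IH // same_init //; ring.
Qed.

Lemma transfer_arr x u : x <= b ->
  Pr P (fun w => A w && agree x b (v w) u && arr v chi j 0 x w) =
  c * Pr P' (fun w => A' w && agree (x + m) (b + m) (v' w) (transl m u)
                      && arr v' chi' j' 0 (x + m) w).
Proof.
move=> xb; have c1 := Pr_arr_cvg M (e := 0) (x := x) (event_pat M x u).
have c2 := Pr_arr_cvg M' (e := 0) (x := x + m) (event_pat M' (x + m) (transl m u)).
apply: cvg_unique c1 _ => //.
rewrite (_ : (fun n => _) = fun n => c * Pr P' (fun w =>
   A' w && agree (x + m) (b + m) (v' w) (transl m u) && arr_upto v' chi' j' n 0 (x + m) w)).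
  exact: cvgMr.
by apply/funext => n; exact: transfer_arr_upto.
Qed.

(** [Q_step] is linear with the same coefficients in both models, so a proportionality that holds at
    [x = a] propagates through the block. *)
Lemma transfer_Q a x u h : a <= x <= b ->
  Q P v chi j A b a x u h = c * Q P' v' chi' j' A' (b + m) (a + m) (x + m) (transl m u) h.
Proof.
move=> /andP[ax xb]; move: (xb); have -> : x = a + (absz (x - a)%R)%:Z by lia.
elim: (absz _) u h => [|n IH] u h nb.
  rewrite addr0 in nb *.
  have ma w : mix v chi j A b a a u w = A w && agree a b (v w) u.
    by rewrite /mix agree_nil andbT.
  have ma' w : mix v' chi' j' A' (b + m) (a + m) (a + m) (transl m u) w =
      A' w && agree (a + m) (b + m) (v' w) (transl m u).
    by rewrite /mix agree_nil andbT.
  have Qt : Q P v chi j A b a a u true =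
      c * Q P' v' chi' j' A' (b + m) (a + m) (a + m) (transl m u) true.
    rewrite !Q_true -[RHS]/(c * _); under eq_Pr do rewrite ma.
    by rewrite transfer_arr //; congr (_ * _); apply: eq_Pr => w; rewrite ma'.
  case: h => //; rewrite (Q_false M) (Q_false M') Qt mulrBr; congr (_ - _).
  by rewrite (eq_Pr P ma) (eq_Pr P' ma') same_init.
have nb1 : a <= a + n%:Z < b by lia.
have nb2 : a + n%:Z <= b by lia.
have nb3 : a + m <= a + n%:Z + m < b + m by lia.
rewrite -addn1 PoszD addrA -(upd_id u (a + n%:Z)) transl_upd.
have [q11 q00 q01 q10] := Q_step M u nb1.
have [q'11 q'00 q'01 q'10] := Q_step M' (transl m u) nb3.
rewrite -!transl_upd in q'11 q'00 q'01 q'10 *.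
have E : a + n%:Z + 1 + m = a + n%:Z + m + 1 by rewrite addrAC.
rewrite E; case: (u _); case: h.
- by rewrite q11 q'11 IH.
- by rewrite q10 q'10 !IH //; ring.
- by rewrite q01 q'01 !IH //; ring.
- by rewrite q00 q'00 IH.
Qed.

End Transfer.

(** * Entropy production *)

Section EntropyProduction.
Context {R : realType}.
Implicit Types x y m p : R.

Definition xlnx (x : R) : R := x * ln x.

(** The right side is x ln (x / m) - x + m. Writing x = s^2, m = t^2 and using ln (t / s) <= t / s -
    1 bounds it below by (s - t)^2. *)
Lemma xlnx_tangent x m : 0 <= x -> 0 < m ->
  (Num.sqrt x - Num.sqrt m) ^+ 2 <= xlnx x - xlnx m - (ln m + 1) * (x - m).
Proof.
move=> x0 m0; rewrite /xlnx; set t := Num.sqrt m.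
have t0 : 0 < t by rewrite sqrtr_gt0.
have tE : m = t ^+ 2 by rewrite sqr_sqrtr // ltW.
have [->|xn0] := eqVneq x 0.
  by rewrite sqrtr0 mul0r !sub0r sqrrN -tE; lra.
have xp : 0 < x by rewrite lt_neqAle eq_sym xn0.
set s := Num.sqrt x; have s0 : 0 < s by rewrite sqrtr_gt0.
have sE : x = s ^+ 2 by rewrite sqr_sqrtr.
have lnq : ln t - ln s <= t / s - 1.
  rewrite -ln_div ?posrE // [X in ln X](_ : _ = 1 + (t / s - 1)); last by ring.
  by apply: le_ln1Dx; rewrite ltrBrDr addNr divr_gt0.
rewrite sE tE !lnXn // !mulr2n.
have {}lnq : s ^+ 2 * (ln t - ln s) <= t * s - s ^+ 2.
  have -> : t * s - s ^+ 2 = s ^+ 2 * (t / s - 1) by field; rewrite gt_eqF.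
  by rewrite ler_wpM2l ?sqr_ge0.
nra.
Qed.

(** Jensen's inequality with its defect. Averaging [xlnx_tangent] at the mean [m] cancels the linear
    terms, and the mean square of the roots about any point is at least their variance p (1 - p) (a
    - b)^2. *)
Lemma xlnx_jensen p x y : 0 < p < 1 -> 0 <= x -> 0 <= y ->
  p * (1 - p) * (Num.sqrt x - Num.sqrt y) ^+ 2 <=
  p * xlnx x + (1 - p) * xlnx y - xlnx (p * x + (1 - p) * y).
Proof.
move=> /andP[p0 p1] x0 y0; set m := p * x + _.
have m0 : 0 <= m by rewrite addr_ge0 // mulr_ge0 // ?subr_ge0 ltW.
have [mz|mn] := eqVneq m 0.
  have xz : x = 0 by rewrite /m in mz; nra.
  have yz : y = 0 by rewrite /m xz in mz; nra.
  by rewrite mz xz yz /xlnx subrr expr0n /= !(mul0r, mulr0) addr0 subr0.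
have mp : 0 < m by rewrite lt_neqAle eq_sym mn.
have := xlnx_tangent x0 mp; have := xlnx_tangent y0 mp.
set a := Num.sqrt x; set b := Num.sqrt y; set c := Num.sqrt m.
set fx := xlnx x; set fy := xlnx y; set fm := xlnx m; set L := ln m + 1 => hy hx.
have q0 : 0 < 1 - p by rewrite subr_gt0.
have hx' := ler_wpM2l (ltW p0) hx; have hy' := ler_wpM2l (ltW q0) hy.
have z : p * (L * (x - m)) + (1 - p) * (L * (y - m)) = 0 by rewrite /m; ring.
have sq : 0 <= (p * (a - c) + (1 - p) * (b - c)) ^+ 2 by apply: sqr_ge0.
have sqE : (p * (a - c) + (1 - p) * (b - c)) ^+ 2 =
  p * (a - c) ^+ 2 + (1 - p) * (b - c) ^+ 2 - p * (1 - p) * (a - b) ^+ 2 by ring.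
rewrite sqE in sq; rewrite !mulrBr in hx' hy' z.
lra.
Qed.

Lemma xlnxM x y : 0 <= x -> 0 < y -> xlnx (y * x) = y * xlnx x + y * x * ln y.
Proof.
move=> x0 y0; rewrite /xlnx; have [->|xn] := eqVneq x 0; first by rewrite !(mulr0, mul0r) addr0.
have xp : 0 < x by rewrite lt_neqAle eq_sym xn.
by rewrite lnM ?posrE //; ring.
Qed.

(** Together with [xlnx_halve]: splitting a mass [x + y] in two raises the entropy by between 0 and
    [(x + y) * ln 2], the contribution of one bit. *)
Lemma xlnx_superadd x y : 0 <= x -> 0 <= y -> xlnx x + xlnx y <= xlnx (x + y).
Proof.
move=> x0 y0.
have mono (s t : R) : 0 <= s -> 0 <= t -> s * ln s <= s * ln (s + t).
  move=> s0 t0; have [->|sn] := eqVneq s 0; first by rewrite !mul0r.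
  have sp : 0 < s by rewrite lt_neqAle eq_sym sn.
  by rewrite ler_wpM2l // ler_ln ?posrE ?lerDl // (lt_le_trans sp) // lerDl.
rewrite /xlnx mulrDl lerD //; first exact: mono.
by rewrite addrC; exact: mono.
Qed.

Lemma xlnx_halve x y : 0 <= x -> 0 <= y ->
  xlnx (x + y) - (x + y) * ln 2 <= xlnx x + xlnx y.
Proof.
move=> x0 y0; have h : 0 < (2^-1 : R) < 1 by apply/andP; split; lra.
have := xlnx_jensen h x0 y0.
have -> : 2^-1 * x + (1 - 2^-1) * y = 2^-1 * (x + y) by field.
rewrite (xlnxM (addr_ge0 x0 y0)) ?invr_gt0 // lnV ?posrE //.
have := sqr_ge0 (Num.sqrt x - Num.sqrt y); set s := _ ^+ 2; lra.
Qed.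

(** Factor x - y into difference and sum of the roots and apply the arithmetic-geometric mean
    inequality with a free weight [e]: up to an error of order [e], the squared difference that
    entropy controls bounds the distance. *)
Lemma dist_hellinger e x y : 0 < e -> 0 <= x -> 0 <= y ->
  `|x - y| <= e * (x + y) + (Num.sqrt x - Num.sqrt y) ^+ 2 / (2 * e).
Proof.
move=> e0 x0 y0; set s := Num.sqrt x; set t := Num.sqrt y.
have s0 : 0 <= s by exact: sqrtr_ge0.
have t0 : 0 <= t by exact: sqrtr_ge0.
rewrite -(sqr_sqrtr x0) -(sqr_sqrtr y0) -/s -/t.
have E : e * (s ^+ 2 + t ^+ 2) + (s - t) ^+ 2 / (2 * e) =
   (2 * e ^+ 2 * (s ^+ 2 + t ^+ 2) + (s - t) ^+ 2) / (2 * e).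
  by field; rewrite gt_eqF.
rewrite E ler_pdivlMr ?mulr_gt0 // -[2 * e](ger0_norm (x := 2 * e)) ?mulr_ge0 ?(ltW e0) //.
rewrite -normrM ler_norml; apply/andP; split.
  by have := sqr_ge0 (s - t + e * (s + t)); have := sqr_ge0 (e * (s - t)); nra.
by have := sqr_ge0 (s - t - e * (s + t)); have := sqr_ge0 (e * (s - t)); nra.
Qed.

End EntropyProduction.

(** * Entropy budget of a finite block *)

Section FiniteEntropy.
Context {R : realType}.
Variables (b1 b2 : R).
Hypotheses (b1_01 : 0 < b1 < 1) (b2_01 : 0 < b2 < 1).

Definition odds : R := (1 - b2) / (1 - b1).

Let b1p : 0 < 1 - b1. Proof. by case/andP: b1_01 => _; rewrite subr_gt0. Qed.
Let b2p : 0 < 1 - b2. Proof. by case/andP: b2_01 => _; rewrite subr_gt0. Qed.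
Let b1_gt0 : 0 < b1. Proof. by case/andP: b1_01. Qed.
Let b2_gt0 : 0 < b2. Proof. by case/andP: b2_01. Qed.

Lemma odds_gt0 : 0 < odds.
Proof. by rewrite divr_gt0. Qed.

(* Weighting horizontal arrows by [odds^-1] makes the vertex transition doubly
   stochastic; the last term corrects the entropy for this weight. *)
Lemma vertex_entropy_production x z : 0 <= x -> 0 <= z ->
  b1 * (1 - b1) * (Num.sqrt x - Num.sqrt (odds * z)) ^+ 2
    - ln odds * (z - ((1 - b1) * x + b2 * z)) <=
  xlnx x + xlnx z - xlnx (b1 * x + (1 - b2) * z) - xlnx ((1 - b1) * x + b2 * z).
Proof.
move=> x0 z0; have r0 := odds_gt0; set y := odds * z.
have y0 : 0 <= y by rewrite mulr_ge0 // ltW.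
have n1 : 1 - b1 != 0 by rewrite gt_eqF.
have n2 : 1 - b2 != 0 by rewrite gt_eqF.
have z1 : z = odds^-1 * y by rewrite mulKf // gt_eqF.
have e1 : b1 * x + (1 - b2) * z = b1 * x + (1 - b1) * y.
  by rewrite /y /odds; field.
have e2 : (1 - b1) * x + b2 * z = odds^-1 * (b2 * y + (1 - b2) * x).
  by rewrite /y /odds; field; rewrite n1 n2.
have y'0 : 0 <= b2 * y + (1 - b2) * x by rewrite addr_ge0 // mulr_ge0 // ltW.
have ri : 0 < odds^-1 by rewrite invr_gt0.
have j1 := xlnx_jensen b1_01 x0 y0; have j2 := xlnx_jensen b2_01 y0 x0.
have j2' : xlnx (b2 * y + (1 - b2) * x) <= b2 * xlnx y + (1 - b2) * xlnx x.
  have : 0 <= b2 * (1 - b2) * (Num.sqrt y - Num.sqrt x) ^+ 2.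
    by rewrite mulr_ge0 ?sqr_ge0 // mulr_ge0 // ltW.
  lra.
rewrite e1 e2 (xlnxM y'0 ri) z1 (xlnxM y0 ri) lnV ?posrE //.
have j3 := ler_wpM2l (ltW ri) j2'.
have c3 : odds^-1 * (b2 * xlnx y + (1 - b2) * xlnx x) =
   odds^-1 * xlnx y - (1 - b1) * xlnx y + (1 - b1) * xlnx x.
  by rewrite /odds; field; rewrite n1 n2.
rewrite c3 in j3.
lra.
Qed.

Variable N : nat.
Local Notation U := {ffun 'I_N -> bool}.

Definition updf (u : U) (k : 'I_N) (c : bool) : U := [ffun i => if i == k then c else u i].

(** Each pair of patterns differing only at [k] is met twice as [u] varies; this is the source of
    the factors 2 below. *)
Lemma sum_updf (k : 'I_N) (g : U -> R) :
  \sum_u (g (updf u k true) + g (updf u k false)) = 2 * \sum_u g u.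
Proof.
have E u : g (updf u k true) + g (updf u k false) = g u + g (updf u k (~~ u k)).
  have <- : updf u k (u k) = u by apply/ffunP => i; rewrite ffunE; case: eqP => [->|].
  rewrite !ffunE eqxx; have F a b : updf (updf u k a) k b = updf u k b.
    by apply/ffunP => i; rewrite !ffunE; case: eqP.
  by rewrite !F; case: (u k) => //=; rewrite addrC.
rewrite (eq_bigr _ (fun u _ => E u)) big_split /= mulr_natl mulr2n; congr (_ + _).
rewrite [RHS](reindex_inj (h := fun u => updf u k (~~ u k))) //.
apply: (can_inj (g := fun u => updf u k (~~ u k))) => u.
apply/ffunP => i; rewrite !ffunE eqxx negbK; by case: eqP => [->|].
Qed.

Variable q : nat -> U -> bool -> R.
Hypothesis q_ge0 : forall k u h, 0 <= q k u h.
Hypothesis q_step : forall (k : 'I_N) u,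
  [/\ q k.+1 (updf u k true) true = q k (updf u k true) true,
      q k.+1 (updf u k false) false = q k (updf u k false) false,
      q k.+1 (updf u k false) true =
        (1 - b1) * q k (updf u k true) false + b2 * q k (updf u k false) true &
      q k.+1 (updf u k true) false =
        b1 * q k (updf u k true) false + (1 - b2) * q k (updf u k false) true].
Hypothesis q_flux : forall k : 'I_N, \sum_u q k.+1 u true = \sum_u q k u true.
Hypothesis q_marg : forall u, q N u true + q N u false = q 0 u true + q 0 u false.
Hypothesis q_total : \sum_u (q 0 u true + q 0 u false) = 1.

Definition imbalance (k : 'I_N) (u : U) : R :=
  (Num.sqrt (q k (updf u k true) false)
   - Num.sqrt (odds * q k (updf u k false) true)) ^+ 2.

(** Minus the entropy of the joint law of particles and arrow. *)
Let F k := \sum_u (xlnx (q k u true) + xlnx (q k u false)).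

Let F_decr (k : 'I_N) : b1 * (1 - b1) * \sum_u imbalance k u <= 2 * F k - 2 * F k.+1.
Proof.
rewrite /F -!(sum_updf k).
(* The term in [ln odds] multiplies the change of the total arrow probability at [k]. Patterns with
   both a particle and an arrow are carried over unchanged, so [q_flux] makes the sum vanish. *)
have flux : \sum_u (q k (updf u k false) true - q k.+1 (updf u k false) true) = 0.
  have := q_flux k; move=> /(congr1 (fun t => 2 * t)).
  rewrite -!(sum_updf k) => /eqP; rewrite eq_sym -subr_eq0 -sumrB => /eqP E.
  by rewrite -[RHS]E; apply: eq_bigr => u _; have [-> _ _ _] := q_step k u; lra.
have -> : b1 * (1 - b1) * \sum_u imbalance k u =
    \sum_u (b1 * (1 - b1) * imbalance k u
           - ln odds * (q k (updf u k false) true - q k.+1 (updf u k false) true)).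
  by rewrite sumrB -!mulr_sumr flux mulr0 subr0.
rewrite -sumrB; apply: ler_sum => u _; have [q11 q00 q01 q10] := q_step k u.
have := vertex_entropy_production (q_ge0 k (updf u k true) false)
  (q_ge0 k (updf u k false) true).
by rewrite /imbalance q11 q00 q01 q10; lra.
Qed.

Lemma sum_imbalance : b1 * (1 - b1) * \sum_(k < N) \sum_u imbalance k u <= 2 * ln 2.
Proof.
have tele : \sum_(k < N) (2 * F k - 2 * F k.+1) = 2 * F 0 - 2 * F N.
  rewrite -(big_mkord xpredT (fun k => 2 * F k - 2 * F k.+1)) -[RHS]opprB.
  rewrite -(telescope_sumr (fun k => 2 * F k)) // -sumrN.
  by apply: eq_bigr => k _; rewrite opprB.
rewrite mulr_sumr; apply: le_trans (ler_sum _ (fun k _ => F_decr k)) _.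
rewrite tele -mulrBr ler_pM2l // /F -sumrB -[X in _ <= X]mul1r -[X in _ <= X * _]q_total mulr_suml.
(* The particle marginals at both ends agree, so only the arrow bit counts: superadditivity is used
   at the left end, halving, which costs [ln 2], at the right. *)
apply: ler_sum => u _.
have := xlnx_superadd (q_ge0 0 u true) (q_ge0 0 u false).
have := xlnx_halve (q_ge0 N u true) (q_ge0 N u false).
by rewrite q_marg; lra.
Qed.

(** The arbitrary set [S] of patterns lets the bound pass to marginals on smaller windows. *)
Lemma sum_dist (k : 'I_N) (S : pred U) e : 0 < e ->
  \sum_u q k u false <= 1 -> \sum_u q k u true <= 1 ->
  `|\sum_(u | S u) (q k (updf u k true) false - odds * q k (updf u k false) true)|
  <= 2 * e * (1 + odds) + (\sum_u imbalance k u) / (2 * e).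
Proof.
move=> e0 tot0 tot1; have r0 := odds_gt0.
apply: le_trans (ler_norm_sum _ _ _) _.
apply: (@le_trans _ _ (\sum_u `|q k (updf u k true) false - odds * q k (updf u k false) true|)).
  by rewrite [X in _ <= X](bigID S) /= lerDl sumr_ge0.
apply: (@le_trans _ _ (\sum_u (e * (q k (updf u k true) false + odds * q k (updf u k false) true)
     + imbalance k u / (2 * e)))).
  by apply: ler_sum => u _; apply: dist_hellinger => //; rewrite mulr_ge0 // ltW.
rewrite big_split /= -mulr_suml lerD2r -mulr_sumr [2 * e]mulrC -mulrA ler_pM2l //.
rewrite big_split /= mulrDr mulr1 lerD //.
  have /ler_wpM2l : 0 <= 2 :> R by []; move=> /(_ _ _ tot0); rewrite -(sum_updf k) mulr1.
  by apply: le_trans; apply: ler_sum => u _; rewrite lerDl.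
rewrite -mulr_sumr [2 * odds]mulrC ler_pM2l //.
have /ler_wpM2l : 0 <= 2 :> R by []; move=> /(_ _ _ tot1); rewrite -(sum_updf k) mulr1.
by apply: le_trans; apply: ler_sum => u _; rewrite lerDr.
Qed.

End FiniteEntropy.

(** * Finite patterns, for sums, as total patterns, for windows *)

Section Patterns.
Variable N : nat.

Definition ext (u : {ffun 'I_N -> bool}) (y : int) : bool :=
  if y is Posz i then (if insub i is Some k then u k else false) else false.

Lemma ext_ord u (k : 'I_N) : ext u k%:Z = u k.
Proof. by rewrite /ext valK. Qed.

Lemma ext_updf u (k : 'I_N) c : ext (updf u k c) = upd (ext u) k%:Z c.
Proof.
apply/funext => -[i|i]; rewrite /ext /upd //=; case: insubP => [l li lE|ni].
  by rewrite ffunE -(inj_eq val_inj) lE.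
case: eqP => // -[ik]; by rewrite ik ltn_ord in ni.
Qed.

Lemma agree_ext (eta : int -> bool) u :
  agree 0 N%:Z eta (ext u) <-> forall k : 'I_N, eta k%:Z = u k.
Proof.
split=> [/asboolP h k|h]; first by rewrite h ?ext_ord //; have := ltn_ord k; lia.
apply/asboolP => -[i|//] iN; have lt : (i < N)%N by lia.
by have := h (Ordinal lt); rewrite -ext_ord.
Qed.

Lemma agree_ext_ex (eta : int -> bool) : exists u, agree 0 N%:Z eta (ext u).
Proof. by exists [ffun k : 'I_N => eta k%:Z]; apply/agree_ext => k; rewrite ffunE. Qed.

Lemma agree_ext_inj (eta : int -> bool) u u' :
  agree 0 N%:Z eta (ext u) -> agree 0 N%:Z eta (ext u') -> u = u'.
Proof. by move=> /agree_ext h /agree_ext h'; apply/ffunP => k; rewrite -h -h'. Qed.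

End Patterns.

Lemma agree_trans a b a' b' eta u u' : a <= a' -> b' <= b -> agree a b eta u ->
  agree a' b' eta u' = agree a' b' u u'.
Proof.
move=> aa bb /asboolP h; apply/asboolP/asboolP => h' y yb.
  by rewrite -h' // h //; lia.
by rewrite -h' // h //; lia.
Qed.

(** * Detailed balance for a stationary translation-invariant law *)

Section StationaryStep.
Context {R : realType} {d : measure_display} {T : measurableType d}.
Variables (P : probability T R) (b1 b2 : R).
Variables (v : T -> int -> bool) (chi : int -> T -> bool) (j : int -> T -> nat).
Hypotheses (b1_01 : 0 < b1 < 1) (b2_01 : 0 < b2 < 1).
Hypothesis M : forall b, one_step P b1 b2 v chi j (fun=> true) b.
Hypothesis v_transl : forall (m a b : int) u,
  Pr P (fun w => agree a b (v w) u) = Pr P (fun w => agree (a + m) (b + m) (v w) (transl m u)).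
Local Notation next := (next v chi j).
Local Notation arr := (arr v chi j).
Hypothesis v_stat : forall a b u,
  Pr P (fun w => agree a b (next^~ w) u) = Pr P (fun w => agree a b (v w) u).

Local Notation Q0 b a x u h := (Q P v chi j (fun=> true) b a x u h).
Local Notation mixw w x := (fun y : int => if y < x then next y w else v w y).

(** The step is compared with itself, shifted: in [transfer_Q] the noise enters through [b1] and
    [b2] alone, so invariance of the initial law suffices. *)
Lemma Q_transl (m b a x : int) u h : a <= x <= b ->
  Q0 b a x u h = Q0 (b + m) (a + m) (x + m) (transl m u) h.
Proof.
move=> xab; rewrite -[RHS]mul1r; apply: (transfer_Q (M b) (M (b + m))) => //.
by move=> y u' yb; rewrite mul1r; exact: v_transl.
Qed.

Lemma mix_agree (b a x : int) u w : a <= x <= b ->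
  mix v chi j (fun=> true) b a x u w = agree a b (mixw w x) u.
Proof.
move=> xab; rewrite /mix /=; apply/andP/asboolP => [[/asboolP h1 /asboolP h2] y yab|h].
  by case: ifPn => yx; [apply: h1|apply: h2]; lia.
split; apply/asboolP => y yab; have := h y.
  by rewrite ifT; [apply; lia|lia].
by rewrite ifF; [apply; lia|lia].
Qed.

Lemma Q_agree (b a x : int) u h : a <= x <= b ->
  Q0 b a x u h = Pr P (fun w => agree a b (mixw w x) u && (arr 0 x w == h)).
Proof. by move=> xab; apply: eq_Pr => w; rewrite mix_agree. Qed.

Let event_mixw (x y : int) : event (fun w => mixw w x y).
Proof.
apply: event_if; [exact: event_cst|exact: (event_next (M 0))|exact: (event_init (M 0))].
Qed.

Lemma Q_window (N : nat) (a b x : int) s h : 0 <= a -> a <= x <= b -> b <= N%:Z ->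
  Q0 b a x s h = \sum_(u : {ffun 'I_N -> bool} | agree a b (ext u) s) Q0 N%:Z 0 x (ext u) h.
Proof.
move=> a0 xab bN; rewrite Q_agree //.
have ev f : event f -> event (fun w => f w && (arr 0 x w == h)).
  by move=> mf; apply: event_and => //; apply: event_eqb; exact: event_arr (M 0) _ _.
rewrite (@Pr_sum _ _ _ P {ffun 'I_N -> bool} (fun u w => agree 0 N%:Z (mixw w x) (ext u))).
- rewrite [RHS]big_mkcond /=; apply: eq_bigr => u _; rewrite Q_agree; last lia.
  case: ifPn => [aus|naus].
    apply: eq_Pr => w; case E: (agree 0 _ _ _); last by rewrite andbF.
    by rewrite (agree_trans _ _ _ E) // aus andbT.
  rewrite -[RHS](Pr_false P); apply: eq_Pr => w; case E: (agree 0 _ _ _); last by rewrite andbF.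
  by rewrite (agree_trans _ _ _ E) // (negbTE naus).
- by apply: ev; apply: event_agree => y.
- by move=> u; apply: event_agree => y.
- by move=> w; exact: agree_ext_ex.
- by move=> u u' w; exact: agree_ext_inj.
Qed.

Lemma Pr_arr0_cst (x y : int) : Pr P (arr 0 x) = Pr P (arr 0 y).
Proof.
have E z : Pr P (arr 0 z) = Q0 z z z (fun=> true) true.
  by rewrite Q_agree ?lexx //; apply: eq_Pr => w; rewrite agree_nil eqb_id.
rewrite !E (Q_transl (y - x)) ?lexx // addrC subrK.
exact: eq_Pr.
Qed.

Lemma sum_Q (N : nat) (x : int) h : 0 <= x <= N%:Z ->
  \sum_(u : {ffun 'I_N -> bool}) Q0 N%:Z 0 x (ext u) h = Pr P (fun w => arr 0 x w == h).
Proof.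
move=> xN; have := @Q_window N x x x (fun=> true) h; rewrite lexx => /(_ _ isT).
case/andP: xN => x0 xN /(_ x0 xN); rewrite Q_agree ?lexx // => E.
transitivity (\sum_(u : {ffun 'I_N -> bool} | agree x x (ext u) xpredT) Q0 N%:Z 0 x (ext u) h).
  by apply: eq_bigl => u; rewrite agree_nil.
by rewrite -E; apply: eq_Pr => w; rewrite agree_nil.
Qed.

Lemma Pr_arr_eq_le1 x h : Pr P (fun w => arr 0 x w == h) <= 1.
Proof.
rewrite -(Pr_true P); apply: Pr_le => //.
by apply: event_eqb; exact: event_arr (M 0) _ _.
Qed.

Local Notation r := (odds b1 b2).

(** [I k] bounds the entropy production at [k] from below, up to a constant factor: its sum has a
    bound free of [N], yet each [I k] controls the defect of detailed balance at [k] in every window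
    around [k] inside the block. *)
Lemma window_imbalance (N : nat) :
  exists I : 'I_N -> R, [/\ forall k, 0 <= I k,
   b1 * (1 - b1) * \sum_k I k <= 2 * ln 2 &
   forall (k : 'I_N) a b s e, 0 < e -> 0 <= a -> a <= k%:Z -> k%:Z < b -> b <= N%:Z ->
   2 * `|Q0 b a k%:Z (upd s k%:Z true) false - r * Q0 b a k%:Z (upd s k%:Z false) true|
   <= 2 * e * (1 + r) + I k / (2 * e)].
Proof.
pose q k (u : {ffun 'I_N -> bool}) h := Q0 N%:Z 0 k%:Z (ext u) h.
have q_ge0 k u h : 0 <= q k u h by exact: Pr_ge0.
have Sk (k : nat) : k.+1%:Z = k%:Z + 1 by lia.
have q_step (k : 'I_N) u :
  [/\ q k.+1 (updf u k true) true = q k (updf u k true) true,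
      q k.+1 (updf u k false) false = q k (updf u k false) false,
      q k.+1 (updf u k false) true =
        (1 - b1) * q k (updf u k true) false + b2 * q k (updf u k false) true &
      q k.+1 (updf u k true) false =
        b1 * q k (updf u k true) false + (1 - b2) * q k (updf u k false) true].
  have kN : 0 <= (k : nat)%:Z < N%:Z by have := ltn_ord k; lia.
  by have := Q_step (M N%:Z) (ext u) kN; rewrite /q !ext_updf Sk.
have q_sum k h : (k <= N)%N -> \sum_u q k u h = Pr P (fun w => arr 0 k%:Z w == h).
  by move=> kN; apply: sum_Q; lia.
have q_flux (k : 'I_N) : \sum_u q k.+1 u true = \sum_u q k u true.
  rewrite !q_sum //; last exact: ltnW.
  transitivity (Pr P (arr 0 k.+1%:Z)); first by apply: eq_Pr => w; rewrite eqb_id.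
  by rewrite (Pr_arr0_cst _ k%:Z); apply: eq_Pr => w; rewrite eqb_id.
(* At the right end [mix] consists of new particles, at the left end of old ones; stationarity
   identifies their laws. *)
have q_marg u : q N u true + q N u false = q 0%N u true + q 0%N u false.
  rewrite /q -!(Q_sum (M _)).
  rewrite (eq_Pr P (g := fun w => agree 0 N%:Z (next^~ w) (ext u))); last first.
    by move=> w; rewrite /mix agree_nil andbT.
  rewrite v_stat; apply: eq_Pr => w.
  by rewrite /mix agree_nil.
have q_total : \sum_u (q 0%N u true + q 0%N u false) = 1.
  rewrite big_split /= !q_sum // -(Pr_true P); apply/esym/Pr_add.
  - by apply: event_eqb; exact: event_arr (M 0) _ _.
  - by apply: event_eqb; exact: event_arr (M 0) _ _.
  - by move=> w; case: (arr _ _ _).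
  - by move=> w; case: (arr _ _ _).
exists (fun k => \sum_u imbalance b1 b2 q k u); split.
- by move=> k; apply: sumr_ge0 => u _; exact: sqr_ge0.
- exact: sum_imbalance.
- move=> k a b s e e0 a0 ak kb bN.
  have kN : (k <= N)%N by exact: ltnW.
  have tot h : \sum_u q k u h <= 1 by rewrite q_sum //; exact: Pr_arr_eq_le1.
  (* Both patterns are set to [true] at [k], so [S] ignores that site and selects agreement with [s]
     on the rest of the window. *)
  pose S (u : {ffun 'I_N -> bool}) := agree a b (upd (ext u) k%:Z true) (upd s k%:Z true).
  have upd_agree (f : int -> bool) c c' :
      agree a b (upd f k%:Z c) (upd s k%:Z c') =
      (c == c') && agree a b (upd f k%:Z true) (upd s k%:Z true).
    apply/asboolP/andP => [h|[/eqP -> /asboolP h] y yab]; last first.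
      by have := h y yab; rewrite /upd; case: eqP.
    split; first by have := h k%:Z; rewrite /upd eqxx => -> //; lia.
    by apply/asboolP => y yab; have := h y yab; rewrite /upd; case: eqP.
  have Qc c h : 2 * Q0 b a k%:Z (upd s k%:Z c) h = \sum_(u | S u) q k (updf u k c) h.
    rewrite (@Q_window N) //; last by rewrite ak ltW.
    rewrite big_mkcond /= -(sum_updf k) [RHS]big_mkcond /=; apply: eq_bigr => u _.
    rewrite !ext_updf (upd_agree _ true c) (upd_agree _ false c) -/(S u) /q.
    by case: c; case: (S u); rewrite /= ?ext_updf ?addr0 ?add0r.
  have -> : 2 * `|Q0 b a k%:Z (upd s k%:Z true) false - r * Q0 b a k%:Z (upd s k%:Z false) true|
      = `|\sum_(u | S u) (q k (updf u k true) false - r * q k (updf u k false) true)|.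
    rewrite sumrB -mulr_sumr -!Qc -[X in X * `|_|](@ger0_norm _ 2) // -normrM; congr (`|_|); ring.
  exact: sum_dist.
Qed.

(** By translation a defect [D > 0] would occur at [n] consecutive sites of one block of length
    [B + n], each taking a fixed part of a budget that does not grow with [n]. *)
Lemma detailed_balance (b a x : int) s : a <= x < b ->
  Q0 b a x (upd s x true) false = r * Q0 b a x (upd s x false) true.
Proof.
move=> /andP[ax xb]; apply/eqP; rewrite -subr_eq0 -normr_eq0 eq_le normr_ge0 andbT.
set D := `|_|; rewrite leNgt; apply/negP => D0.
have b1p : 0 < b1 * (1 - b1) by case/andP: b1_01 => ? ?; rewrite mulr_gt0 // subr_gt0.
have r0 : 0 < r by exact: odds_gt0.
have [B BE] : exists B : nat, B%:Z = b - a by exists (absz (b - a)%R); lia.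
have [x0 x0E] : exists x0 : nat, x0%:Z = x - a by exists (absz (x - a)%R); lia.
have x0B : (x0 < B)%N by lia.
(* With this [e] the error term [2 * e * (1 + r)] equals [D], half of the [2 * D] to be bounded; the
   other half is left for [I]. *)
pose e := D / (2 * (1 + r)).
have r1 : 0 < 1 + r by rewrite addr_gt0.
have e0 : 0 < e by rewrite divr_gt0 // mulr_gt0.
have eE : 2 * e * (1 + r) = D by rewrite /e; field; rewrite gt_eqF.
have bound n : n%:R * D <= 2 * ln 2 / (b1 * (1 - b1)) / (2 * e).
  have [N NE] : exists N : nat, N = (B + n)%N by exists (B + n)%N.
  have x0N : (x0 + n <= N)%N by rewrite NE leq_add2r ltnW.
  have [I [I0 sumI bI]] := window_imbalance N.
  pose I' i := if insub i is Some k then I k else 0.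
  have I'0 i : 0 <= I' i by rewrite /I'; case: insubP.
  have bI' i : (x0 <= i < x0 + n)%N -> D <= I' i / (2 * e).
    move=> /andP[ix iN]; have lt : (i < N)%N by exact: leq_trans iN x0N.
    have [t tE] : exists t : int, t = i%:Z - x by exists (i%:Z - x).
    have E c h : Q0 b a x (upd s x c) h =
        Q0 (b + t) (a + t) (Ordinal lt : nat)%:Z (upd (transl t s) (Ordinal lt : nat)%:Z c) h.
      rewrite (Q_transl t) ?ax ?(ltW xb) //= transl_upd.
      by rewrite (_ : x + t = i%:Z) // tE addrC subrK.
    have t1 : 0 <= a + t by clear -tE ix x0E; lia.
    have t2 : a + t <= (Ordinal lt : nat)%:Z by clear -tE ax; rewrite /=; lia.
    have t3 : (Ordinal lt : nat)%:Z < b + t by clear -tE xb; rewrite /=; lia.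
    have t4 : b + t <= N%:Z by clear -tE NE iN x0E BE; lia.
    have := bI (Ordinal lt) (a + t) (b + t) (transl t s) e e0.
    rewrite -!E -/D eE /I' insubT //= => /(_ t1 t2 t3 t4).
    by rewrite [2 * D]mulr_natl mulr2n lerD2l.
  have : \sum_(x0 <= i < x0 + n) D <= \sum_(x0 <= i < x0 + n) (I' i / (2 * e)).
    by rewrite big_nat [X in _ <= X]big_nat; apply: ler_sum => i; exact: bI'.
  rewrite sumr_const_nat addKn -[D *+ n]mulr_natl => /le_trans; apply.
  rewrite -mulr_suml; apply: ler_wpM2r; first by rewrite invr_ge0 mulr_ge0 // ltW.
  rewrite ler_pdivlMr // mulrC.
  apply: le_trans sumI; rewrite ler_pM2l //.
  have -> : \sum_k I k = \sum_(0 <= i < N) I' i.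
    by rewrite big_mkord; apply: eq_bigr => k _; rewrite /I' valK.
  rewrite [X in _ <= X](@big_cat_nat _ _ _ x0) //=; first last.
    by apply: leq_trans x0N; rewrite leq_addr.
  rewrite [X in _ <= _ + X](@big_cat_nat _ _ _ (x0 + n) x0) ?leq_addr //=.
  by rewrite addrCA lerDl addr_ge0 // sumr_ge0.
set K := _ / (2 * e) in bound.
have K0 : 0 <= K by have := bound 0%N; rewrite mul0r.
have := bound (Num.bound (K / D)); apply/negP; rewrite -ltNge -ltr_pdivrMr //.
by apply: archi_boundP; rewrite divr_ge0 // ltW.
Qed.

End StationaryStep.

(** * Exchangeability *)

Lemma updC u x y c c' : x != y -> upd (upd u x c) y c' = upd (upd u y c') x c.
Proof.
move=> xy; apply/funext => z; rewrite /upd; case: (z =P y) => [->|] //.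
by rewrite eq_sym (negbTE xy).
Qed.

Section Exchangeability.
Context {R : realType} {d : measure_display} {T : measurableType d}.
Variables (P : probability T R) (b1 b2 : R).
Variables (v : T -> int -> bool) (chi : int -> T -> bool) (j : int -> T -> nat).
Hypotheses (b1_01 : 0 < b1 < 1) (b2_01 : 0 < b2 < 1).
Hypothesis M : forall b, one_step P b1 b2 v chi j (fun=> true) b.
Hypothesis v_transl : forall (m a b : int) u,
  Pr P (fun w => agree a b (v w) u) = Pr P (fun w => agree (a + m) (b + m) (v w) (transl m u)).
Local Notation next := (next v chi j).
Hypothesis v_stat : forall a b u,
  Pr P (fun w => agree a b (next^~ w) u) = Pr P (fun w => agree a b (v w) u).

Local Notation Q0 b a x u h := (Q P v chi j (fun=> true) b a x u h).
Local Notation r := (odds b1 b2).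

Let balance (b a x : int) s : a <= x < b ->
  Q0 b a x (upd s x true) false = r * Q0 b a x (upd s x false) true.
Proof. exact: (@detailed_balance _ _ _ P b1 b2). Qed.

(** Since [r * (1 - b1) = 1 - b2], detailed balance makes the vertex kernel act as the identity:
    what one of the two mixing states loses, it gets back from the other. *)
Lemma Q_const (b a x : int) u h : a <= x <= b -> Q0 b a x u h = Q0 b a a u h.
Proof.
have b1n : 1 - b1 != 0 by case/andP: b1_01 => _; rewrite lt_neqAle => /andP[+ _]; rewrite subr_eq0 eq_sym.
have rE : r * (1 - b1) = 1 - b2 by rewrite /odds divfK.
move=> /andP[ax xb]; move: (xb); have -> : x = a + (absz (x - a)%R)%:Z by lia.
elim: (absz _) u h => [|n IH] u h nb; first by rewrite addr0.
have nb1 : a <= a + n%:Z < b by lia.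
have nb2 : a + n%:Z <= b by lia.
rewrite -addn1 PoszD addrA -(IH _ _ nb2) -(upd_id u (a + n%:Z)).
have [q11 q00 q01 q10] := Q_step (M b) u nb1; have bal := balance u nb1.
case: (u _); case: h => //.
  rewrite q10 bal -rE; ring.
by rewrite q01 bal mulrA [(1 - b1) * _]mulrC rE; ring.
Qed.

Lemma Pr_mix (b a x : int) u : a <= x <= b ->
  Pr P (fun w => agree a x (next^~ w) u && agree x b (v w) u) =
  Pr P (fun w => agree a b (v w) u).
Proof.
move=> xab; have ab : a <= a <= b by lia.
have E y : Pr P (fun w => agree a y (next^~ w) u && agree y b (v w) u) =
    Q0 b a y u true + Q0 b a y u false by rewrite -(Q_sum (M b)).
rewrite E !(Q_const _ _ xab) -E.
by apply: eq_Pr => w; rewrite agree_nil.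
Qed.

(** The arrow is a reservoir that, by [Q_const], can be exchanged with any site. With an arrow, both
    masses are [r^-1] times that of occupied [x] and [y] without arrow; with none, both are [r]
    times that of empty [x] and [y] with an arrow. *)
Lemma pattern_exchange (a b x y : int) u : a <= x < b -> a <= y < b -> x != y ->
  Pr P (fun w => agree a b (v w) (upd (upd u x true) y false)) =
  Pr P (fun w => agree a b (v w) (upd (upd u x false) y true)).
Proof.
move=> xab yab xy; have r0 : 0 < r by exact: odds_gt0.
have ab : a <= a <= b by lia.
have E s : Pr P (fun w => agree a b (v w) s) = Q0 b a a s true + Q0 b a a s false.
  by rewrite -(Q_sum (M b)); apply: eq_Pr => w; rewrite /mix agree_nil.
have bal z s : a <= z < b -> Q0 b a a (upd s z true) false = r * Q0 b a a (upd s z false) true.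
  by move=> zab; have zab' : a <= z <= b by [lia]; rewrite -!(Q_const _ _ zab') balance.
rewrite !E; congr (_ + _).
  have rn : r != 0 by rewrite gt_eqF.
  apply: (mulfI rn); rewrite -(bal y) // [upd (upd u x false) y true]updC // -(bal x) //.
  by rewrite updC.
rewrite [upd (upd u x true) y false]updC // (bal x) // (bal y) //.
by rewrite [upd (upd u x false) y false]updC.
Qed.

End Exchangeability.

(** * Laws on configurations, determined by windows *)

Section ConfigMeasurability.

Lemma measurable_site (x : int) (c : bool) : measurable [set eta : config | eta x = c].
Proof. by apply: sub_sigma_algebra; exists x, c. Qed.

Lemma event_site (x : int) : event (fun eta : config => eta x).
Proof. exact: (measurable_site x true). Qed.

Lemma event_window a b u : event (fun eta : config => agree a b eta u).
Proof. by apply: event_agree => x; exact: event_site. Qed.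

Lemma measurable_config (d : measure_display) (T : measurableType d) (f : T -> config) :
  (forall x, event (fun w => f w x)) -> measurable_fun setT f.
Proof.
move=> mf; apply: (@measurability _ _ _ _ setT f cyl_gen) => // _ [_ [x [c ->]] <-].
rewrite setTI (_ : _ @^-1` _ = [set w | f w x == c]); first exact: (event_eqb c (mf x)).
by apply/seteqP; split=> w /= /eqP.
Qed.

(** A generating family closed under intersection. The least radius [n0] allows comparing laws only
    on windows that contain given sites. *)
Definition windows (n0 : nat) : set (set config) :=
  [set A | [\/ A = set0, A = setT | exists (n : nat) (u : int -> bool),
     (n0 <= n)%N /\ A = [set eta : config | agree (- n%:Z) n%:Z eta u]]].

Lemma windows_setI n0 : setI_closed (windows n0).
Proof.
move=> A B [->|->|[n [u [n0n ->]]]]; first by rewrite set0I; constructor.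
  by rewrite setTI.
case=> [->|->|[m [u' [n0m ->]]]]; first by rewrite setI0; constructor.
  by rewrite setIT; constructor 3; exists n, u.
wlog nm : n m u u' n0n n0m / (n <= m)%N => [W|].
  have [nm|/ltnW nm] := leqP n m; first exact: W.
  by rewrite setIC; exact: W.
have E (eta : config) : agree (- m%:Z) m%:Z eta u' ->
    agree (- n%:Z) n%:Z eta u = agree (- n%:Z) n%:Z u' u.
  by apply: agree_trans; lia.
case uu: (agree (- n%:Z) n%:Z u' u); last first.
  by constructor; apply/seteqP; split=> // eta [/= + h]; rewrite E // uu.
constructor 3; exists m, u'; split=> //; apply/seteqP; split=> [eta []//|eta /= h].
by rewrite E // uu.
Qed.

Lemma windows_generate n0 : @measurable _ config = <<s windows n0 >>.
Proof.
apply/seteqP; split.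
  apply: smallest_sub; first exact: smallest_sigma_algebra.
  move=> _ [x [c ->]].
  pose n := (n0 + (absz x).+1)%N; pose N := (n + n)%N.
  have xn : - n%:Z <= x < n%:Z by rewrite /n; lia.
  rewrite (_ : [set _ | _] = \bigcup_(u in [set u : {ffun 'I_N -> bool} |
      transl (- n%:Z) (ext u) x == c])
      [set eta : config | agree (- n%:Z) n%:Z eta (transl (- n%:Z) (ext u))]).
    pose GT := g_sigma_algebraType (windows n0).
    apply: (@fin_bigcup_measurable _ GT) => [|u _]; first exact: finite_finset.
    apply: sub_sigma_algebra; constructor 3; exists n; exists (transl (- n%:Z) (ext u)).
    by rewrite leq_addr.
  apply/seteqP; split=> [eta /= ec|eta [u /= /eqP uc /asboolP ->//]].
  have [u uE] := agree_ext_ex N (fun y => eta (y - n%:Z)).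
  have uE' : agree (- n%:Z) n%:Z eta (transl (- n%:Z) (ext u)).
    apply/asboolP => y yn; rewrite /transl opprK.
    by move/asboolP: uE => <-; rewrite ?addrK // /N; lia.
  by exists u => //=; move/asboolP: uE' => <- //; apply/eqP.
apply: smallest_sub; first exact: sigma_algebra_measurable.
by move=> _ [->|->|[n [u [_ ->]]]] //; exact: event_window.
Qed.

Lemma config_measure_unique (R : realType) (m1 m2 : {measure set config -> \bar R}) n0 :
  (m1 setT < +oo)%E -> m1 setT = m2 setT ->
  (forall (n : nat) u, (n0 <= n)%N ->
    m1 [set eta : config | agree (- n%:Z) n%:Z eta u] =
    m2 [set eta : config | agree (- n%:Z) n%:Z eta u]) ->
  forall A : set config, measurable A -> m1 A = m2 A.
Proof.
move=> fin eqT eqm A mA; apply: (measure_unique (windows n0) (fun=> setT)) => //.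
- exact: windows_generate.
- exact: windows_setI.
- by move=> _; constructor 2.
- by apply/seteqP; split=> // eta _; exists 0%N.
- by move=> B [->|->|[n [u [n0n ->]]]]; rewrite ?measure0 // eqm.
Qed.

Definition image_measure {R : realType} {d d' : measure_display} {T : measurableType d}
    {T' : measurableType d'} (m : {measure set T -> \bar R}) (f : T -> T')
    (mf : measurable_fun setT f) : {measure set T' -> \bar R} :=
  measure_function_pushforward__canonical__measure_function_Measure m mf.

(** Trivial events and [c = 1] give equality of laws; other choices compare laws restricted to
    events, as conditioning requires. *)
Lemma config_law_unique (R : realType) (d1 d2 : measure_display)
    (T1 : measurableType d1) (T2 : measurableType d2)
    (P1 : probability T1 R) (P2 : probability T2 R)
    (f1 : T1 -> config) (f2 : T2 -> config) (E1 : T1 -> bool) (E2 : T2 -> bool) (c : R) n0 :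
  (forall x, event (fun w => f1 w x)) -> (forall x, event (fun w => f2 w x)) ->
  event E1 -> event E2 -> 0 <= c -> Pr P1 E1 = c * Pr P2 E2 ->
  (forall (n : nat) u, (n0 <= n)%N ->
     Pr P1 (fun w => E1 w && agree (- n%:Z) n%:Z (f1 w) u) =
     c * Pr P2 (fun w => E2 w && agree (- n%:Z) n%:Z (f2 w) u)) ->
  forall A : set config, measurable A ->
    P1 (f1 @^-1` A `&` [set w | E1 w]) = (c%:E * P2 (f2 @^-1` A `&` [set w | E2 w]))%E.
Proof.
move=> mf1 mf2 mE1 mE2 c0 eqT eqw A mA.
have wE (d : measure_display) (T : measurableType d) (f : T -> config) (E : T -> bool) n u :
    f @^-1` [set eta : config | agree (- n%:Z) n%:Z eta u] `&` [set w | E w] =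
    [set w | E w && agree (- n%:Z) n%:Z (f w) u].
  apply/seteqP; split=> [w /= [h1 h2]|w /= /andP[h1 h2]]; [exact/andP|by split].
have mw n u (d : measure_display) (T : measurableType d) (f : T -> config) (E : T -> bool) :
    (forall x, event (fun w => f w x)) -> event E ->
    event (fun w => E w && agree (- n%:Z) n%:Z (f w) u).
  by move=> mf mE; apply: event_and => //; exact: event_agree.
pose m1 := image_measure (mrestr P1 mE1) (measurable_config mf1).
pose m2 := mscale (NngNum c0) (image_measure (mrestr P2 mE2) (measurable_config mf2)).
apply: (config_measure_unique (m1 := m1) (m2 := m2) (n0 := n0)) => //.
- rewrite /m1 /= /pushforward /mrestr preimage_setT setTI PrE //; exact: ltry.
- rewrite /m1 /m2 /= /mscale /= /pushforward /mrestr !preimage_setT !setTI.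
  by rewrite !PrE // eqT EFinM.
- move=> n u n0n; rewrite /m1 /m2 /= /mscale /= /pushforward /mrestr !wE !PrE; try exact: mw.
  by rewrite eqw // EFinM.
Qed.

End ConfigMeasurability.

(** * Exchangeable laws and the removal of a site *)

Definition swap (x y : int) (eta : config) : config :=
  fun z => if z == x then eta y else if z == y then eta x else eta z.

Definition drop0 (eta : config) : config :=
  fun z => if z < 0 then eta z else eta (z + 1).

(** A finite permutation that coincides with [drop0] to the left of [n] and parks the value of site
    0 at [n]; exchangeability applies to it directly. *)
Definition cyc (n : nat) (eta : config) : config :=
  fun z => if 0 <= z < n%:Z then eta (z + 1) else if z == n%:Z then eta 0 else eta z.

Lemma event_reindex (f : config -> config) (s : int -> int) :
  (forall eta x, f eta x = eta (s x)) -> forall x, event (fun eta => f eta x).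
Proof. by move=> fE x; apply: eq_event (event_site (s x)) => eta; rewrite fE. Qed.

Lemma event_swap x y z : event (fun eta => swap x y eta z).
Proof.
apply: (@event_reindex _ (fun z => if z == x then y else if z == y then x else z)) => eta t.
by rewrite /swap; case: eqP => // _; case: eqP.
Qed.

Lemma event_drop0 z : event (fun eta => drop0 eta z).
Proof.
apply: (@event_reindex _ (fun z => if z < 0 then z else z + 1)) => eta t.
by rewrite /drop0; case: ifP.
Qed.

Lemma measurable_drop0 (A : set config) : measurable A -> measurable (drop0 @^-1` A).
Proof.
move=> mA; rewrite -[X in measurable X]setTI.
by apply: measurable_config => // x; exact: event_drop0.
Qed.

Lemma event_shift m z : event (fun eta => Defs.shift m eta z).
Proof. by apply: (@event_reindex _ (fun z => z + m)). Qed.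

Lemma cycS n eta : cyc n.+1 eta = swap n%:Z n.+1%:Z (cyc n eta).
Proof.
apply/funext => z; rewrite /cyc /swap.
have [->|zn] := eqVneq z n%:Z.
  rewrite ifT; last lia.
  rewrite ifF; last lia.
  rewrite ifF; last lia.
  by congr eta; lia.
have [->|zn1] := eqVneq z n.+1%:Z.
  rewrite ifF; last lia.
  by rewrite ifF ?eqxx //; lia.
rewrite (_ : (0 <= z < n.+1%:Z) = (0 <= z < n%:Z)) //.
by move/eqP: zn; lia.
Qed.

Section Exchangeable.
Context {R : realType}.
Variable mu : probability config R.
Hypothesis exch : forall (a b x y : int) u, a <= x < b -> a <= y < b -> x != y ->
  Pr mu (fun eta : config => agree a b eta (upd (upd u x true) y false)) =
  Pr mu (fun eta : config => agree a b eta (upd (upd u x false) y true)).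

Let law_unique (f1 f2 : config -> config) n0 :
  (forall x, event (fun eta => f1 eta x)) -> (forall x, event (fun eta => f2 eta x)) ->
  (forall (n : nat) u, (n0 <= n)%N ->
     Pr mu (fun eta => agree (- n%:Z) n%:Z (f1 eta) u) =
     Pr mu (fun eta => agree (- n%:Z) n%:Z (f2 eta) u)) ->
  forall A : set config, measurable A -> mu (f1 @^-1` A) = mu (f2 @^-1` A).
Proof.
move=> m1 m2 eqw A mA.
have TE : [set eta : config | true] = setT by apply/seteqP; split.
have := @config_law_unique _ _ _ _ _ mu mu f1 f2 (fun=> true) (fun=> true) 1 n0 m1 m2
  (event_cst true) (event_cst true) ler01.
rewrite mul1r TE => /(_ erefl _ A mA); rewrite !setIT mul1e; apply.
by move=> n u n0n; rewrite mul1r; exact: eqw.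
Qed.

Lemma swap_law x y (A : set config) : x != y -> measurable A ->
  mu (swap x y @^-1` A) = mu A.
Proof.
move=> xy mA; apply: (@law_unique (swap x y) id (absz x + absz y).+1 _ _ _ A mA).
- exact: event_swap.
- exact: event_site.
move=> n u ln /=.
have E (eta : config) : agree (- n%:Z) n%:Z (swap x y eta) u = agree (- n%:Z) n%:Z eta (swap x y u).
  pose t z := if z == x then y else if z == y then x else z.
  have sE (f : int -> bool) z : swap x y f z = f (t z).
    by rewrite /swap /t; case: eqP => // _; case: eqP.
  have tK z : t (t z) = z.
    rewrite /t; case: (eqVneq z x) => [->|zx]; first by rewrite eqxx; case: eqP.
    by case: (eqVneq z y) => [->|zy]; rewrite ?eqxx // (negbTE zx) (negbTE zy).
  have tn z : - n%:Z <= z < n%:Z -> - n%:Z <= t z < n%:Z.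
    by rewrite /t; case: eqP => [_|_]; [lia|case: eqP => [_|_]; lia].
  apply: asbool_equiv_eq; split=> h z zn; last by rewrite sE h ?sE ?tK //; exact: tn.
  by rewrite sE -h ?sE ?tK //; exact: tn.
rewrite (eq_Pr mu E).
case ux: (u x); case uy: (u y).
- by congr Pr; apply/funext => eta; congr agree; apply/funext => z; rewrite /swap;
    case: eqP => [->|_]; rewrite ?ux ?uy //; case: eqP => [->|_]; rewrite ?ux ?uy.
- have -> : swap x y u = upd (upd u x false) y true.
    apply/funext => z; rewrite /swap /upd; case: eqP => [->|_]; first by rewrite (negbTE xy) uy.
    by case: eqP.
  have {2}-> : u = upd (upd u x true) y false.
    by rewrite -ux -uy; apply/funext => z; rewrite /upd; case: eqP => [->//|_]; case: eqP => [->|].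
  by apply/esym/exch => //; lia.
- have -> : swap x y u = upd (upd u x true) y false.
    apply/funext => z; rewrite /swap /upd; case: eqP => [->|_]; first by rewrite (negbTE xy) uy.
    by case: eqP.
  have {2}-> : u = upd (upd u x false) y true.
    by rewrite -ux -uy; apply/funext => z; rewrite /upd; case: eqP => [->//|_]; case: eqP => [->|].
  by apply/exch => //; lia.
- by congr Pr; apply/funext => eta; congr agree; apply/funext => z; rewrite /swap;
    case: eqP => [->|_]; rewrite ?ux ?uy //; case: eqP => [->|_]; rewrite ?ux ?uy.
Qed.

Lemma cyc_law n (A : set config) : measurable A -> mu (cyc n @^-1` A) = mu A.
Proof.
elim: n A => [|n IH] A mA.
  congr (mu _); apply/seteqP; split=> eta /=; rewrite (_ : cyc 0 eta = eta) //;
    apply/funext => z; rewrite /cyc ifF ?lerNgt //; try lia; by case: eqP => [->|].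
have -> : cyc n.+1 @^-1` A = cyc n @^-1` (swap n%:Z n.+1%:Z @^-1` A).
  by apply/seteqP; split=> eta /=; rewrite cycS.
rewrite IH; first by rewrite swap_law //; lia.
rewrite -[X in measurable X]setTI; apply: measurable_config => //.
by move=> x; exact: event_swap.
Qed.

Lemma cyc_Pr n f : event f -> Pr mu (fun eta => f (cyc n eta)) = Pr mu f.
Proof. by move=> mf; rewrite /Pr -(cyc_law n mf). Qed.

Lemma cyc_drop0 (x : int) (n : nat) (eta : config) u :
  agree x n%:Z (cyc n eta) u = agree x n%:Z (drop0 eta) u.
Proof.
have E y : x <= y < n%:Z -> cyc n eta y = drop0 eta y.
  rewrite /cyc /drop0 => yn; have [y0|y0] := ltP y 0; last by rewrite ifT //; lia.
  by rewrite /= ifF //; lia.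
by apply: asbool_equiv_eq; split=> h y yn; rewrite -h // E.
Qed.

(** Under [cyc n] the forgotten site becomes the one just right of the window, where conditioning on
    it is out of the way of the dynamics. *)
Lemma drop0_window c (x : int) (n : nat) u :
  Pr mu (fun eta : config => (eta 0 == c) && agree x n%:Z (drop0 eta) u) =
  Pr mu (fun eta : config => (eta n%:Z == c) && agree x n%:Z eta u).
Proof.
rewrite -[RHS](cyc_Pr n); last first.
  by apply: event_and; [exact: event_eqb (event_site _)|exact: event_window].
apply: eq_Pr => eta; rewrite cyc_drop0; congr (_ && _).
by rewrite /cyc ltxx andbF eqxx.
Qed.

Lemma drop0_law (A : set config) : measurable A -> mu (drop0 @^-1` A) = mu A.
Proof.
move=> mA; apply: (@law_unique drop0 id 0 _ _ _ A mA).
- exact: event_drop0.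
- exact: event_site.
move=> n u _ /=; rewrite -[RHS](cyc_Pr n); last exact: event_window.
by apply: eq_Pr => eta; rewrite cyc_drop0.
Qed.

Definition site0 c := fun eta : config => eta 0 == c.

Lemma event_site0 c : event (site0 c).
Proof. exact: event_eqb (event_site _). Qed.

Lemma Pr_site0_false : Pr mu (site0 false) = 1 - Pr mu (site0 true).
Proof.
have := Pr_split mu (event_cst true) (event_site0 true); rewrite Pr_true => ->.
by rewrite addrAC subrr add0r; apply: eq_Pr => eta; rewrite /site0 /=; case: (eta 0).
Qed.

(** The law of the remaining sites given the value [c] at 0. The second [mu] is only the default of
    [mnormalize] for a null condition. *)
Definition cond_drop (c : bool) : probability config R :=
  mnormalize (image_measure (mrestr mu (event_site0 c)) (measurable_config event_drop0)) mu.

Lemma cond_dropE c (A : set config) : 0 < Pr mu (site0 c) ->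
  cond_drop c A = (mu (drop0 @^-1` A `&` [set eta | site0 c eta]) * (Pr mu (site0 c))^-1%:E)%E.
Proof.
move=> p0; rewrite /cond_drop /= /mnormalize /=.
have -> : pushforward (mrestr mu (event_site0 c)) drop0 setT = (Pr mu (site0 c))%:E.
  by rewrite /pushforward /mrestr preimage_setT setTI PrE //; exact: event_site0.
by rewrite eqe gt_eqF.
Qed.

Lemma Pr_cond_drop c f : 0 < Pr mu (site0 c) -> event f ->
  Pr (cond_drop c) f = Pr mu (fun eta => site0 c eta && f (drop0 eta)) / Pr mu (site0 c).
Proof.
move=> p0 mf; rewrite {1}/Pr cond_dropE //.
rewrite (_ : _ `&` _ = [set eta | site0 c eta && f (drop0 eta)]).
  rewrite PrE //; apply: event_and; first exact: event_site0.
  exact: measurable_drop0 mf.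
by apply/seteqP; split=> [w /= [h1 h2]|w /= /andP[h1 h2]]; [apply/andP|split].
Qed.

Lemma cond_drop_window c (x : int) (n : nat) u : 0 < Pr mu (site0 c) ->
  Pr mu (fun eta : config => (eta n%:Z == c) && agree x n%:Z eta u) =
  Pr mu (site0 c) * Pr (cond_drop c) (fun eta => agree x n%:Z eta u).
Proof.
move=> p0; rewrite Pr_cond_drop //; last exact: event_window.
by rewrite mulrC divfK ?gt_eqF // -drop0_window.
Qed.

Lemma cond_drop_mixture (A : set config) : 0 < Pr mu (site0 true) < 1 -> measurable A ->
  mu A = ((Pr mu (site0 true))%:E * cond_drop true A
          + (1 - Pr mu (site0 true))%:E * cond_drop false A)%E.
Proof.
move=> /andP[p0 p1] mA.
have mdA := measurable_drop0 mA.
have q0 : 0 < Pr mu (site0 false) by rewrite Pr_site0_false subr_gt0.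
rewrite -Pr_site0_false !cond_dropE // !muleA ![(_%:E * mu _)%E]muleC -!muleA -!EFinM.
rewrite !divff ?gt_eqF // !mule1 -drop0_law //.
rewrite {1}(_ : drop0 @^-1` A = (drop0 @^-1` A `&` [set eta | site0 true eta])
   `|` (drop0 @^-1` A `&` [set eta | site0 false eta])).
  rewrite measureU //; try by apply: measurableI => //; exact: event_site0.
  by apply/seteqP; split=> // eta /= [[_ +] [_]]; rewrite /site0; case: (eta 0).
rewrite -setIUr setIidl //.
by move=> eta _ /=; rewrite /site0; case: (eta 0); [left|right].
Qed.

Hypothesis ti : translation_invariant mu.

Lemma shift_Pr m f : event f -> Pr mu (fun eta => f (Defs.shift m eta)) = Pr mu f.
Proof. by move=> mf; rewrite /Pr -(ti m mf). Qed.

(** By [cond_drop_window] the conditioning site can sit at the right end of any window; window and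
    site are shifted together, and invariance of [mu] applies. Negative shifts follow by
    inversion. *)
Lemma cond_drop_ti c : 0 < Pr mu (site0 c) -> translation_invariant (cond_drop c).
Proof.
move=> p0; have nneg (m : nat) (A : set config) : measurable A ->
    cond_drop c (Defs.shift m%:Z @^-1` A) = cond_drop c A.
  move=> mA; have TE : [set eta : config | true] = setT by apply/seteqP; split.
  have := @config_law_unique _ _ _ _ _ (cond_drop c) (cond_drop c) (Defs.shift m%:Z) id
    (fun=> true) (fun=> true) 1 0 (event_shift m%:Z) event_site
    (event_cst true) (event_cst true) ler01.
  rewrite mul1r TE => /(_ erefl _ A mA); rewrite !setIT mul1e; apply.
  move=> n u _; rewrite mul1r /=.
  apply: (mulfI (lt0r_neq0 p0)); rewrite -cond_drop_window //.
  have E (eta : config) : agree (- n%:Z) n%:Z (Defs.shift m%:Z eta) u =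
      agree (- n%:Z + m%:Z) (n + m)%N%:Z eta (transl m%:Z u).
    apply: asbool_equiv_eq; split=> h y yn.
      by rewrite /transl -h ?/Defs.shift ?subrK //; lia.
    by rewrite /Defs.shift h ?/transl ?addrK //; lia.
  rewrite (eq_Pr _ E) -cond_drop_window // -[RHS](shift_Pr m%:Z); last first.
    by apply: event_and; [exact: event_eqb (event_site _)|exact: event_window].
  by apply: eq_Pr => eta; rewrite E /Defs.shift PoszD.
case=> m A mA; first exact: nneg.
have mA' : measurable (Defs.shift (Negz m) @^-1` A).
  by rewrite -[X in measurable X]setTI; apply: measurable_config => // x; exact: event_shift.
rewrite -(nneg m.+1 _ mA'); congr (cond_drop c _).
apply/seteqP; split=> eta /=; rewrite (_ : Defs.shift _ (Defs.shift _ eta) = eta) //;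
  by apply/funext => z; rewrite /Defs.shift NegzE addrNK.
Qed.

End Exchangeable.

(** * Independent digits and existence of the process *)

Section UniformDigits.
Context {R : realType}.
Local Notation RR := (measurableTypeR R).
Local Notation leb := (@lebesgue_measure R).

Lemma lebesgue_measure_affine (a p : R) (A : set RR) : 0 < p -> measurable A ->
  leb ((fun u : RR => (u - a) / p : RR) @^-1` A) = (p%:E * leb A)%E.
Proof.
move=> p0 mA; pose g (u : RR) : RR := (u - a) / p.
have mg : measurable_fun setT g.
  by apply: measurable_funM => //; apply: measurable_funB.
have ip0 : 0 <= p^-1 by rewrite invr_ge0 ltW.
pose m := mscale (NngNum ip0) (image_measure leb mg).
have mE B : m B = ((p^-1)%:E * leb (g @^-1` B))%E by [].
suff -> : leb A = m A by rewrite mE muleA -EFinM divff ?gt_eqF // mul1e.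
apply: lebesgue_measure_unique => // _ [[c e] _ <-] /=.
transitivity ((p^-1)%:E * leb (g @^-1` `]c, e]%classic))%E; last by [].
rewrite (_ : g @^-1` _ = `]p * c + a, p * e + a]%classic).
  rewrite !lebesgue_measure_itv /= !lte_fin ltrD2r ltr_pM2l //.
  case: ifP => _; last by rewrite mule0.
  by rewrite -!EFinB -EFinM; congr (_%:E); field; rewrite gt_eqF.
apply/seteqP; split=> u; rewrite /g /= !in_itv /= ltr_pdivlMr // ler_pdivrMr //;
  by rewrite ltrBrDr lerBlDr ![_ * p]mulrC.
Qed.

Definition unit_itv : set RR := `[0, 1[%classic.

Lemma measurable_unit_itv : measurable unit_itv.
Proof. exact: measurable_itv. Qed.

Definition unif : set RR -> \bar R := mrestr leb measurable_unit_itv.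
HB.instance Definition _ := Measure.on unif.

Let unif_setT : unif setT = 1%E.
Proof.
by rewrite /unif /mrestr setTI /unit_itv lebesgue_measure_itv /= lte_fin ltr01 -EFinB subr0.
Qed.
HB.instance Definition _ := Measure_isProbability.Build _ _ _ unif unif_setT.

(* [F] is a cumulative distribution: the digit of [u] is the [r] such that
   [F r <= u < F r.+1], and [rest F u] the relative position of [u] there. *)
Record cumulative (F : nat -> R) : Prop := Cumulative {
  cumulative0 : F 0%N = 0;
  cumulativeS : forall r, F r <= F r.+1;
  cumulative1 : forall r, F r <= 1;
  cumulative_sup : forall u, u < 1 -> exists r, u < F r }.

Definition cell (F : nat -> R) (r : nat) : set RR := `[F r, F r.+1[%classic.
Definition digit (F : nat -> R) (u : RR) : nat := xget 0%N [set r | cell F r u].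
Definition rest (F : nat -> R) (u : RR) : RR :=
  (u - F (digit F u)) / (F (digit F u).+1 - F (digit F u)).

Section OneDigit.
Variable F : nat -> R.
Hypothesis HF : cumulative F.

Lemma cumulative_le m n : (m <= n)%N -> F m <= F n.
Proof.
move=> /subnK <-; elim: (n - m)%N => // k IH.
by apply: le_trans IH _; rewrite addSn; exact: cumulativeS HF _.
Qed.

Lemma cell_unit r : cell F r `<=` unit_itv.
Proof.
move=> u; rewrite /cell /unit_itv /= !in_itv /= => /andP[h1 h2]; apply/andP; split.
  by apply: le_trans h1; rewrite -(cumulative0 HF) cumulative_le.
exact: lt_le_trans h2 (cumulative1 HF _).
Qed.

Lemma cell_inj m n u : cell F m u -> cell F n u -> m = n.
Proof.
rewrite /cell /= !in_itv /= => /andP[h1 h2] /andP[h3 h4].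
have [mn|mn|//] := ltngtP m n.
  by have := lt_le_trans h2 (cumulative_le mn); rewrite ltNge h3.
by have := lt_le_trans h4 (cumulative_le mn); rewrite ltNge h1.
Qed.

Lemma cell_cover u : unit_itv u -> exists r, cell F r u.
Proof.
rewrite /unit_itv /= in_itv /= => /andP[u0 u1].
have ex := cumulative_sup HF u1; have := ex_minnP ex; move=> [[|m] um min_m].
  by move: um; rewrite (cumulative0 HF) ltNge u0.
exists m; rewrite /cell /= in_itv /= um andbT leNgt; apply/negP => /min_m.
by rewrite ltnn.
Qed.

Lemma digit_cell u r : cell F r u -> digit F u = r.
Proof. by move=> h; rewrite /digit; case: xgetP => [n -> hn|/(_ r)]; [exact: cell_inj hn h|]. Qed.

Lemma digitP u r : unit_itv u -> (digit F u = r) <-> cell F r u.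
Proof.
move=> /cell_cover[n hn]; split=> [<-|]; last exact: digit_cell.
by rewrite (digit_cell hn).
Qed.

Lemma measurable_cell r : measurable (cell F r).
Proof. exact: measurable_itv. Qed.

Lemma measurable_digit (B : set nat) : measurable (digit F @^-1` B).
Proof.
have -> : digit F @^-1` B = \bigcup_(r in B) cell F r `|`
    ([set u | B 0%N] `&` ~` (\bigcup_r cell F r)).
  apply/seteqP; split=> u /=.
    move=> Bu; have [[r _ hr]|nh] := pselect ((\bigcup_r cell F r) u).
      by left; exists r => //; rewrite -(digit_cell hr).
    right; split=> //; move: Bu; rewrite /digit xgetPN // => r hr.
    by apply: nh; exists r.
  case=> [[r Br hr]|[B0 nh]]; first by rewrite (digit_cell hr).
  by rewrite /digit xgetPN // => r hr; apply: nh; exists r.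
apply: measurableU; first by apply: bigcup_measurable => r _; exact: measurable_cell.
apply: measurableI; last by apply: measurableC; apply: bigcupT_measurable => r; exact: measurable_cell.
have [B0|B0] := pselect (B 0%N).
  by rewrite (_ : [set u | _] = setT) //; apply/seteqP; split.
by rewrite (_ : [set u | _] = set0) //; apply/seteqP; split.
Qed.

Definition relpos r (u : RR) : RR := (u - F r) / (F r.+1 - F r).

Lemma measurable_relpos r : measurable_fun setT (relpos r).
Proof. by apply: measurable_funM => //; apply: measurable_funB. Qed.

Lemma measurable_rest : measurable_fun setT (rest F).
Proof.
move=> _ A mA; rewrite setTI.
have -> : rest F @^-1` A = \bigcup_r (digit F @^-1` [set r] `&` relpos r @^-1` A).
  apply/seteqP; split=> u /=; first by exists (digit F u).
  by move=> [r _ [/= <-]].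
apply: bigcupT_measurable => r; apply: measurableI; first exact: measurable_digit.
by rewrite -[X in measurable X]setTI; exact: measurable_relpos.
Qed.

(** On the cell of [r], [rest] is an affine bijection onto the unit interval whose preimages are
    scaled by the length of the cell: the remainder is again uniform and independent of the
    digit. *)
Lemma unif_digit_rest r (A : set RR) : measurable A ->
  unif (digit F @^-1` [set r] `&` rest F @^-1` A) = ((F r.+1 - F r)%:E * unif A)%E.
Proof.
move=> mA; rewrite /unif /mrestr.
(* An empty cell: [rest] would divide by zero, but no point of the unit interval has this digit. *)
have [e|ne] := eqVneq (F r) (F r.+1).
  rewrite e subrr mul0e (_ : _ `&` _ = set0) ?measure0 //.
  apply/seteqP; split=> // u [[/= du _] uu].
  have /digitP := uu => /(_ r) [/(_ du) + _].
  by rewrite /cell /= in_itv /= e; case: ltP => //; rewrite andbF.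
have p0 : 0 < F r.+1 - F r by rewrite subr_gt0 lt_neqAle ne (cumulativeS HF).
rewrite -(lebesgue_measure_affine (F r)) //; last by apply: measurableI => //; exact: measurable_unit_itv.
congr (leb _); apply/seteqP; split=> u /=.
  move=> [[/= du +] uu]; rewrite /rest du => Au; split=> //.
  have /digitP := uu => /(_ r) [/(_ du) + _].
  rewrite /cell /unit_itv /= !in_itv /= => /andP[h1 h2].
  by rewrite divr_ge0 ?subr_ge0 ?(cumulativeS HF) //= ltr_pdivrMr // mul1r ltrD2r.
move=> [Au]; rewrite /unit_itv /= in_itv /= ltr_pdivrMr // mul1r ltrD2r => /andP[h1 h2].
have h : cell F r u.
  rewrite /cell /= in_itv /= h2 andbT -subr_ge0.
  by move: h1; rewrite pmulr_lge0 // invr_gt0.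
have uu := cell_unit h; have du := digit_cell h.
by split; [split; rewrite // /rest du|].
Qed.

Lemma unif_digit r : unif (digit F @^-1` [set r]) = (F r.+1 - F r)%:E.
Proof.
have := unif_digit_rest r (@measurableT _ RR).
by rewrite preimage_setT setIT probability_setT mule1.
Qed.

Lemma unif_digits_rest (B : set nat) (A : set RR) : measurable A ->
  unif (digit F @^-1` B `&` rest F @^-1` A) = (unif (digit F @^-1` B) * unif A)%E.
Proof.
move=> mA.
have mD r : measurable (digit F @^-1` [set r] `&` rest F @^-1` A).
  apply: measurableI; first exact: measurable_digit.
  by rewrite -[X in measurable X]setTI; exact: measurable_rest.
have BE : digit F @^-1` B = \bigcup_(r in B) digit F @^-1` [set r].
  by apply/seteqP; split=> u /=; [exists (digit F u)|move=> [r Br /= ->]].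
have tr (G : nat -> set RR) : (forall r, G r `<=` digit F @^-1` [set r]) -> trivIset B G.
  move=> GD; apply/trivIsetP => i k _ _ ik; apply/seteqP; split=> // u [/GD /= di /GD /= dk].
  by move/eqP: ik; apply; rewrite -di.
rewrite BE setI_bigcupl !measure_bigcup; try by move=> r _; first [exact: mD|exact: measurable_digit].
- rewrite (eq_eseriesr (fun r _ => unif_digit_rest r mA)).
  rewrite (eq_eseriesr (fun r _ => unif_digit r)).
  have fA : unif A \is a fin_num by rewrite fin_num_measure.
  rewrite -(fineK fA) muleC -nneseriesZl; last by move=> r _; rewrite lee_fin subr_ge0 (cumulativeS HF).
  by apply: eq_eseriesr => r _; rewrite muleC.
- by apply: tr => r u.
- by apply: tr => r u [].
Qed.

End OneDigit.

Fixpoint ndigit (F : nat -> nat -> R) (n : nat) (u : RR) : nat :=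
  if n is n'.+1 then ndigit (fun k => F k.+1) n' (rest (F 0%N) u) else digit (F 0%N) u.

Lemma measurable_ndigit F n (B : set nat) : (forall k, cumulative (F k)) ->
  measurable (ndigit F n @^-1` B).
Proof.
elim: n F => [|n IH] F HF; first exact: measurable_digit.
rewrite (_ : _ @^-1` _ = rest (F 0%N) @^-1` (ndigit (fun k => F k.+1) n @^-1` B)) //.
by rewrite -[X in measurable X]setTI; apply: measurable_rest => //; exact: IH.
Qed.

Lemma unif_rest F (A : set RR) : cumulative F -> measurable A -> unif (rest F @^-1` A) = unif A.
Proof.
move=> HF mA; have := unif_digits_rest HF setT mA.
by rewrite preimage_setT setTI probability_setT mul1e.
Qed.

Lemma unif_ndigit F n r : (forall k, cumulative (F k)) ->
  unif (ndigit F n @^-1` [set r]) = (F n r.+1 - F n r)%:E.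
Proof.
elim: n F => [|n IH] F HF; first exact: unif_digit.
rewrite (_ : _ @^-1` _ = rest (F 0%N) @^-1` (ndigit (fun k => F k.+1) n @^-1` [set r])) //.
by rewrite unif_rest //; [exact: IH|exact: measurable_ndigit].
Qed.

(** The later digits are functions of [rest], which is uniform and independent of the first
    digit. *)
Lemma unif_ndigits F N (B : nat -> set nat) : (forall k, cumulative (F k)) ->
  unif (\big[setI/setT]_(n < N) (ndigit F n @^-1` B n)) =
  (\prod_(n < N) unif (ndigit F n @^-1` B n))%E.
Proof.
elim: N F B => [|N IH] F B HF; first by rewrite !big_ord0 probability_setT.
rewrite !big_ord_recl.
pose C := \big[setI/setT]_(n < N) (ndigit (fun k => F k.+1) n @^-1` B n.+1).
have mC : measurable C.
  by apply: bigsetI_measurable => n _; exact: measurable_ndigit.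
rewrite (_ : \big[setI/setT]_(i < N) _ = rest (F 0%N) @^-1` C); last first.
  rewrite /C; elim/big_rec2: _ => [|i x y _ ->]; first by rewrite preimage_setT.
  by rewrite preimage_setI.
have IHC : unif C = _ := IH (fun k => F k.+1) (fun k => B k.+1) (fun k => HF k.+1).
rewrite unif_digits_rest // IHC; congr (_ * _)%E.
apply: eq_bigr => i _; rewrite -(unif_rest (HF 0%N)) //.
exact: measurable_ndigit.
Qed.

End UniformDigits.

(** * A realization of the process *)

Section Realization.
Context {R : realType}.
Variables (b1 b2 : R).
Hypotheses (b1_01 : 0 < b1 < 1) (b2_01 : 0 < b2 < 1).
Local Notation RR := (measurableTypeR R).

(** Digit 0 has mass [b1], so [chi] holds on a zero digit. In the geometric case digit [r] has mass
    [(1 - b2) * b2 ^+ r], so the jump is the digit plus one. *)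
Definition bernoulli_cumulative (r : nat) : R :=
  if r is r'.+1 then (if r' is _.+1 then 1 else b1) else 0.
Definition geometric_cumulative (r : nat) : R := 1 - b2 ^+ r.

Lemma bernoulli_cumulativeP : cumulative bernoulli_cumulative.
Proof.
case/andP: b1_01 => h0 h1; split=> //=.
- by case=> [|[|r]] //=; rewrite ltW.
- by case=> [|[|r]] //=; rewrite ?ler01 ?ltW.
- by move=> u u1; exists 2.
Qed.

Lemma geometric_cumulativeP : cumulative geometric_cumulative.
Proof.
case/andP: b2_01 => h0 h1; rewrite /geometric_cumulative; split.
- by rewrite expr0 subrr.
- by move=> r; rewrite lerD2l lerN2 exprS ler_piMl ?exprn_ge0 // ltW.
- by move=> r; rewrite gerBl exprn_ge0 // ltW.
- move=> u u1; have : (fun n => b2 ^+ n : R^o) @ \oo --> (0 : R^o).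
    by apply: cvg_expr; rewrite ger0_norm // ltW.
  move=> /cvgrPdist_lt /(_ (1 - u)); rewrite subr_gt0 => /(_ u1) [n _ /(_ n)] /=.
  rewrite leqnn sub0r normrN ger0_norm ?exprn_ge0 ?(ltW h0) // => /(_ isT) h.
  by exists n; lra.
Qed.

Definition noise_index : Type := (bool * (nat * int))%type.

Definition cum (n : nat) : nat -> R :=
  if @pickle_inv noise_index n is Some (true, _) then geometric_cumulative
  else bernoulli_cumulative.

Lemma cumP n : cumulative (cum n).
Proof.
rewrite /cum; case: (pickle_inv n) => [[[] _]|];
  by [exact: geometric_cumulativeP|exact: bernoulli_cumulativeP].
Qed.

Definition dig (i : noise_index) (u : RR) : nat := ndigit cum (pickle i) u.

Lemma measurable_dig i (B : set nat) : measurable (dig i @^-1` B).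
Proof. exact: measurable_ndigit cumP. Qed.

Lemma unif_dig i r : @unif R (dig i @^-1` [set r]) =
  (if i.1 then (1 - b2) * b2 ^+ r else bernoulli_cumulative r.+1 - bernoulli_cumulative r)%:E.
Proof.
rewrite /dig unif_ndigit; last exact: cumP.
rewrite /cum pickleK_inv; case: i => [[] tx] //=.
by congr (_%:E); rewrite /geometric_cumulative exprS; ring.
Qed.

Lemma unif_digs (l : seq noise_index) (B : noise_index -> set nat) : uniq l ->
  @unif R (\big[setI/setT]_(i <- l) (dig i @^-1` B i)) =
  (\prod_(i <- l) @unif R (dig i @^-1` B i))%E.
Proof.
move=> ul; have [N lN] : exists N, forall i, i \in l -> (pickle i < N)%N.
  by exists (\max_(i <- l) pickle i).+1 => i il; rewrite ltnS; exact: leq_bigmax_seq.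
pose B' n := if @pickle_inv noise_index n is Some i then (if i \in l then B i else setT) else setT.
have B'l i : i \in l -> B' (pickle i) = B i by move=> il; rewrite /B' pickleK_inv il.
have B'n n : n \notin map pickle l -> B' n = setT.
  rewrite /B'; case E: (pickle_inv n) => [i|//]; case: ifP => // il /negP[].
  apply/mapP; exists i => //; have := pickle_invK (T := noise_index) n.
  by rewrite E.
rewrite (_ : \big[setI/setT]_(i <- l) _ = \big[setI/setT]_(n < N) (ndigit cum n @^-1` B' n)).
  rewrite unif_ndigits; last exact: cumP.
  rewrite -(big_mkord xpredT (fun n => @unif R (ndigit cum n @^-1` B' n))).
  rewrite (bigID (fun n => n \in map pickle l)) /= [X in (_ * X)%E]big1 ?mule1; last first.
    by move=> n nl; rewrite B'n // preimage_setT probability_setT.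
  rewrite -big_filter (perm_big (map pickle l)) /=; last first.
    apply: uniq_perm.
    - by apply: filter_uniq; exact: iota_uniq.
    - by rewrite map_inj_uniq //; exact: pcan_inj pickleK.
    move=> n; rewrite mem_filter mem_index_iota /=.
    by case E: (n \in _) => //=; move/mapP: E => [i il ->]; exact: lN.
  by rewrite big_map big_seq [RHS]big_seq; apply: eq_bigr => i il; rewrite B'l.
rewrite -(bigcap_mkord N (fun n => ndigit cum n @^-1` B' n)) -bigcap_seq; apply/seteqP; split=> u h.
  move=> n /= nN; case nl: (n \in map pickle l); last by rewrite B'n // nl.
  by move/mapP: nl => [i il ->]; rewrite B'l //; exact: h.
by move=> i /= il; rewrite -B'l //; apply: h => /=; exact: lN.
Qed.

Variable mu : probability config R.

Definition space := (config * RR)%type.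
Definition law : probability space R := (mu \x @unif R)%E.

Lemma lawE (A : set config) (C : set RR) : measurable A -> measurable C ->
  law (A `*` C) = (mu A * @unif R C)%E.
Proof. by move=> mA mC; rewrite /law /= product_measure1E. Qed.

Lemma law_snd (C : set RR) : measurable C -> law (snd @^-1` C) = @unif R C.
Proof.
move=> mC; rewrite (_ : snd @^-1` C = setT `*` C) ?lawE ?probability_setT ?mul1e //.
by apply/seteqP; split=> -[? ?] //= [].
Qed.

Lemma law_fst (A : set config) : measurable A -> law (fst @^-1` A) = mu A.
Proof.
move=> mA; rewrite (_ : fst @^-1` A = A `*` setT) ?lawE ?probability_setT ?mule1 //.
by apply/seteqP; split=> -[? ?] //= [].
Qed.

Definition real_chi (t : nat) (x : int) (w : space) : bool := dig (false, (t, x)) w.2 == 0%N.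
Definition real_j (t : nat) (x : int) (w : space) : nat := (dig (true, (t, x)) w.2).+1.

Lemma measurable_snd_dig i (B : set nat) :
  measurable ((fun w : space => dig i w.2) @^-1` B).
Proof.
rewrite (_ : _ @^-1` _ = setT `*` (dig i @^-1` B)).
  by apply: measurableX => //; exact: measurable_dig.
by apply/seteqP; split=> -[? ?] //= [].
Qed.

(** Through this instance the stationarity of [mu], a statement about all realizations, can be used.
    Initial configuration and noise live on the two factors of a product. *)
Lemma realization : sv_realization b1 b2 mu law fst real_chi real_j.
Proof.
have chiE t x (B : set bool) : real_chi t x @^-1` B =
    snd @^-1` (dig (false, (t, x)) @^-1` [set r | B (r == 0%N)]) by [].
have jE t x (B : set nat) : real_j t x @^-1` B =
    snd @^-1` (dig (true, (t, x)) @^-1` [set r | B r.+1]) by [].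
split.
- split; first exact: measurable_fst.
  by split=> t x B; [rewrite chiE|rewrite jE]; exact: measurable_snd_dig.
- exact: law_fst.
- move=> t x _; rewrite chiE law_snd; last exact: measurable_dig.
  rewrite (_ : [set r | _] = [set 0%N]); first by rewrite unif_dig /= subr0.
  by apply/seteqP; split=> [r /= /eqP //|r /= ->].
- move=> t x [//|r] _ _; rewrite jE law_snd; last exact: measurable_dig.
  rewrite (_ : [set _ | _] = [set r]); first by rewrite unif_dig.
  by apply/seteqP; split=> [k /= [] //|k /= ->].
move=> s E us _ HE.
pose l := pmap id s.
have lE i : (i \in l) = (Some i \in s) by rewrite mem_pmap map_id.
have ul : uniq l by apply: (pmap_uniq (g := Some)) us; case.
have [A mA EA] : exists2 A : set config, measurable A & None \in s -> E None = fst @^-1` A.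
  case Ns: (None \in s); last by exists setT.
  by have /= [A mA <-] := HE _ Ns; exists A.
have HB i : exists B : set nat, Some i \in s -> E (Some i) = snd @^-1` (dig i @^-1` B).
  case Si: (Some i \in s); last by exists setT.
  case: i Si => [[] [t x]] Si; have /= [B _ <-] := HE _ Si.
    by exists [set r | B r.+1].
  by exists [set r | B (r == 0%N)].
pose B i := projT1 (cid (HB i)).
have EB i : Some i \in s -> E (Some i) = snd @^-1` (dig i @^-1` B i).
  exact: projT2 (cid (HB i)).
pose A' := if None \in s then A else setT.
have mA' : measurable A' by rewrite /A'; case: ifP.
pose C := \big[setI/setT]_(i <- l) (dig i @^-1` B i).
have mC : measurable C by apply: bigsetI_measurable => i _; exact: measurable_dig.
have -> : \big[setI/setT]_(i <- s) E i = A' `*` C.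
  rewrite /C -!bigcap_seq; apply/seteqP; split=> -[eta u] /=.
    move=> h; split; last first.
      by move=> i /=; rewrite lE => iS; have := h _ iS; rewrite EB.
    by rewrite /A'; case Ns: (None \in s) => //; have := h _ Ns; rewrite EA.
  move=> [hA hC] [i|] /= iS.
    by rewrite EB //; apply: hC; rewrite /= lE.
  by rewrite EA //; move: hA; rewrite /A' iS.
rewrite lawE // unif_digs //.
have ps : perm_eq s ((if None \in s then [:: None] else [::]) ++ map Some l).
  apply: uniq_perm => //.
    rewrite cat_uniq map_inj_uniq ?ul ?andbT; last by move=> ? ? [].
    rewrite (_ : uniq _ = true) /=; last by case: ifP.
    by apply/hasPn => _ /mapP[i _ ->]; case: ifP.
  case=> [i|]; rewrite mem_cat.
    by rewrite mem_map ?lE; [case: ifP|move=> ? ? []].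
  case: ifP => //= _; apply/esym/negP => /mapP[? //].
rewrite (perm_big _ ps) big_cat big_map /=; congr (_ * _)%E.
  rewrite /A'; case: ifP => Ns; last by rewrite big_nil probability_setT.
  by rewrite big_seq1 EA // law_fst.
rewrite big_seq [RHS]big_seq; apply: eq_bigr => i; rewrite lE => iS.
by rewrite EB // law_snd //; exact: measurable_dig.
Qed.

End Realization.

(** * Markov property *)

Definition late (i : sv_index) : bool :=
  if i is Some (_, (t, _)) then (1 < t)%N else false.

Section FromRealization.
Context {R : realType} {b1 b2 : R}.
Hypotheses (b1_01 : 0 < b1 < 1) (b2_01 : 0 < b2 < 1).
Context {nu : probability config R}.
Context {d : measure_display} {T : measurableType d} {P : probability T R}.
Context {eta0 : T -> config} {chi : nat -> int -> T -> bool} {j : nat -> int -> T -> nat}.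
Hypothesis real : sv_realization b1 b2 nu P eta0 chi j.

Let mchi t x (B : pred bool) : event (fun w => B (chi t x w)).
Proof. by case: real => -[_ [h _]] _ _ _ _; exact: (h t x [set c | B c]). Qed.

Let mj t x (C : pred nat) : event (fun w => C (j t x w)).
Proof. by case: real => -[_ [_ h]] _ _ _ _; exact: (h t x [set c | C c]). Qed.

Let meta (A : set config) : measurable A -> measurable (eta0 @^-1` A).
Proof.
case: real => -[h _] _ _ _ _ mA; rewrite -[X in measurable X]setTI; exact: h.
Qed.

Let Peta (A : set config) : measurable A -> P (eta0 @^-1` A) = nu A.
Proof. by case: real => _ h _ _ _; exact: h. Qed.

Lemma Pr_jump_gt x e : Pr P (fun w => (e < j 1 x w)%N) = b2 ^+ e.
Proof.
case/andP: b2_01 => h0 h1.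
have pt r : Pr P (fun w => j 1 x w == r.+1) = (1 - b2) * b2 ^+ r.
  case: real => _ _ _ h _; have := h 1%N x r.+1 isT isT.
  rewrite /Pr (_ : [set w | _] = j 1 x @^-1` [set r.+1]); first by move=> ->.
  by apply/seteqP; split=> w /= /eqP.
have rec k : Pr P (fun w => (k < j 1 x w)%N) =
    (1 - b2) * b2 ^+ k + Pr P (fun w => (k.+1 < j 1 x w)%N).
  rewrite -pt; apply: Pr_add.
  - exact: (mj 1 x (fun n => n == k.+1)).
  - exact: (mj 1 x (fun n => k.+1 < n)%N).
  - by move=> w /=; rewrite leq_eqVlt eq_sym.
  - by move=> w /= /eqP ->; rewrite ltnn.
have tot k : Pr P (fun w => (0 < j 1 x w)%N) = 1 - b2 ^+ k + Pr P (fun w => (k < j 1 x w)%N).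
  elim: k => [|k ->]; first by rewrite expr0 subrr add0r.
  by rewrite rec exprS; ring.
(* Masses are prescribed for [r >= 1] only; that the jump is almost surely positive follows because
   they add up to 1. *)
have one : Pr P (fun w => (0 < j 1 x w)%N) = 1.
  apply/eqP; rewrite eq_le; apply/andP; split.
    by rewrite -(Pr_true P); apply: Pr_le => //; exact: (mj 1 x (fun n => 0 < n)%N).
  have : (fun n => 1 - b2 ^+ n : R^o) @ \oo --> (1 - 0 : R^o).
    apply: cvgB; first exact: cvg_cst.
    by apply: cvg_expr; rewrite ger0_norm // ltW.
  rewrite subr0 => cv; have <- := cvg_lim (@Rhausdorff R) cv.
  apply: limr_le; first by apply/cvg_ex; exists 1.
  by near=> n; rewrite (tot n) lerDl Pr_ge0.
by have := tot e; rewrite one; lra.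
Unshelve. all: by end_near.
Qed.

Local Notation noise := (noise (chi 1) (j 1)).

Fixpoint noise_prob (l : seq (pred bool * pred nat)) (x : int) : R :=
  if l is (B, C) :: l'
  then Pr P (fun w => B (chi 1 x w)) * Pr P (fun w => C (j 1 x w)) * noise_prob l' (x + 1)
  else 1.

Definition before (x : int) (i : sv_index) : Prop :=
  if i is Some (_, (t, y)) then (t == 1%N) ==> (y < x) else True.

(** The noise is peeled off site by site: the two variables of [x] join the family [s], which stays
    duplicate-free since it contains no first-step noise from [x] on. *)
Lemma indep_noise l x (s : seq sv_index) (E : sv_index -> set T) :
  uniq s -> all sv_used s -> (forall i, i \in s -> before x i) ->
  (forall i, i \in s -> sv_events eta0 chi j i (E i)) ->
  P ((\big[setI/setT]_(i <- s) E i) `&` [set w | noise l x w]) =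
  ((\prod_(i <- s) P (E i)) * (noise_prob l x)%:E)%E.
Proof.
elim: l x s E => [|[B C] l IH] x s E us used bef ev.
  have -> : [set w | noise [::] x w] = setT by apply/seteqP; split.
  by rewrite setIT mule1; case: real => _ _ _ _; exact.
pose i1 : sv_index := Some (false, (1%N, x)).
pose i2 : sv_index := Some (true, (1%N, x)).
pose E' i := if i == i1 then [set w | B (chi 1 x w)]
             else if i == i2 then [set w | C (j 1 x w)] else E i.
have n1 : i1 \notin s by apply/negP => /bef; rewrite /before /= ltxx.
have n2 : i2 \notin s by apply/negP => /bef; rewrite /before /= ltxx.
have E's i : i \in s -> E' i = E i.
  move=> iS; rewrite /E'; case: eqP => [e|_]; first by rewrite -e iS in n1.
  by case: eqP => [e|_] //; rewrite -e iS in n2.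
have i21 : (i2 == i1) = false by apply/eqP.
have E'2 : E' i2 = [set w | C (j 1 x w)] by rewrite /E' i21 eqxx.
have := IH (x + 1) (i1 :: i2 :: s) E'; rewrite !big_cons E'2.
have -> : E' i1 = [set w | B (chi 1 x w)] by rewrite /E' eqxx.
rewrite (eq_big_seq _ E's) [X in (_ * (_ * X) * _)%E](eq_big_seq (fun i => P (E i))); last first.
  by move=> i /E's ->.
rewrite !PrE => [h||]; [|exact: mj|exact: mchi].
transitivity (P (([set w | B (chi 1 x w)] `&` ([set w | C (j 1 x w)] `&`
    \big[setI/setT]_(i <- s) E i)) `&` [set w | noise l (x + 1) w])).
  congr (P _); apply/seteqP; split=> w /=.
    by move=> [hE /and3P[hB hC hn]].
  by move=> [[hB [hC hE]] hn]; split=> //; apply/and3P.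
rewrite h.
- by rewrite /= !EFinM [RHS]muleC [X in (X * _)%E = _]muleA [LHS]muleAC.
- by rewrite /= inE negb_or n2 n1 us.
- by rewrite /= used.
- move=> i; rewrite !inE => /orP[/eqP ->|/orP[/eqP ->|/bef]].
  + by rewrite /before /= ltrDl.
  + by rewrite /before /= ltrDl.
  + case: i => [[c [t y]]|//]; rewrite /before => /implyP h1; apply/implyP => /h1 yx.
    by apply: lt_trans yx _; rewrite ltrDl.
- move=> i; rewrite !inE => /orP[/eqP ->|/orP[/eqP ->|iS]].
  + by rewrite /E' eqxx /=; exists [set c | B c].
  + by rewrite E'2; exists [set c | C c].
  + by rewrite E's //; exact: ev.
Qed.

Lemma Pr_noiseE l x : Pr P (noise l x) = noise_prob l x.
Proof.
have := @indep_noise l x [::] (fun=> setT) isT isT; rewrite !big_nil setTI mul1e /Pr => ->//.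
Qed.

(** [G] records later noise, for the Markov property; [K] is a condition on the initial
    configuration, for conditioning on a site. *)
Lemma realization_one_step (K : config -> bool) (s : seq sv_index) (E : sv_index -> set T) b :
  event K -> uniq s -> all late s ->
  (forall i, i \in s -> sv_events eta0 chi j i (E i)) ->
  let G w := `[< (\big[setI/setT]_(i <- s) E i) w >] in
  event G /\ (forall f, event f -> Pr P (fun w => G w && f (eta0 w)) = Pr P G * Pr nu f) /\
  one_step P b1 b2 eta0 (chi 1) (j 1) (fun w => G w && K (eta0 w)) b.
Proof.
move=> mK us ls ev G.
have used : all sv_used s by apply: sub_all ls => -[[c [t y]]|] //=; exact: ltnW.
have bef x i : i \in s -> before x i.
  move=> /(allP ls); case: i => [[c [t y]]|] // t1; apply/implyP => /eqP e.
  by rewrite e in t1.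
have nN : None \notin s by apply/negP => /(allP ls).
have mE i : i \in s -> measurable (E i).
  move=> iS; have := ev _ iS; have := allP ls _ iS; case: i {iS} => [[[] [t y]]|//] _ [B _ <-].
    by case: real => -[_ [_ h]] _ _ _ _; exact: h.
  by case: real => -[_ [h _]] _ _ _ _; exact: h.
have GE : [set w | G w] = \big[setI/setT]_(i <- s) E i.
  by apply/seteqP; split=> w /= /asboolP.
have mG : event G.
  rewrite /event GE; rewrite big_seq; apply: bigsetI_measurable => i iS; exact: mE.
have PG : P [set w | G w] = (\prod_(i <- s) P (E i))%E.
  by rewrite GE; case: real => _ _ _ _; exact.
pose E' (f : config -> bool) i := if i is None then eta0 @^-1` [set eta | f eta] else E i.
have E's f i : i \in s -> E' f i = E i by case: i => //; rewrite (negbTE nN).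
have GN f l x : event f ->
    P [set w | G w && f (eta0 w) && noise l x w] =
    (P [set w | G w] * nu [set eta | f eta] * (noise_prob l x)%:E)%E.
  move=> mf; have := @indep_noise l x (None :: s) (E' f).
  rewrite !big_cons (eq_big_seq _ (E's f)).
  rewrite [X in ((_ * X) * _)%E](eq_big_seq (fun i => P (E i))); last by move=> i /E's ->.
  rewrite -PG -GE Peta // [X in (X * _)%E]muleC => <-.
  - congr (P _); apply/seteqP; split=> w /=; first by move=> /andP[/andP[]].
    by move=> [[-> ->] ->].
  - by rewrite /= nN.
  - by rewrite /= used.
  - by move=> i; rewrite inE => /orP[/eqP -> //|/bef].
  - move=> i; rewrite inE => /orP[/eqP ->|iS]; last by rewrite E's //; exact: ev.
    by exists [set eta | f eta].
have Gf f : event f -> P [set w | G w && f (eta0 w)] = (P [set w | G w] * nu [set eta | f eta])%E.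
  move=> mf; have := GN f [::] 0 mf; rewrite mule1 => <-.
  by congr (P _); apply/seteqP; split=> w /=; rewrite andbT.
have meta0 f : event f -> event (fun w => f (eta0 w)) by move=> mf; exact: meta mf.
split=> //; split.
  move=> f mf; apply: EFin_inj; rewrite EFinM -!PrE //; first exact: Gf.
  by apply: event_and => //; exact: meta0.
split.
- by move=> x; exact: (meta0 (fun eta : config => eta x) (event_site x)).
- by move=> x; exact: (mchi 1 x id).
- by move=> x C; exact: mj.
- by apply: event_and => //; exact: meta0.
- move=> x; case: real => _ _ h _ _; apply: EFin_inj; rewrite -(h 1%N x isT) -PrE //.
  exact: (mchi 1 x id).
- exact: Pr_jump_gt.
- by move=> x B C l; rewrite !Pr_noiseE.
- move=> x u l; rewrite Pr_noiseE.
  have mf : event (fun eta : config => K eta && agree x b eta u).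
    by apply: event_and => //; exact: event_window.
  have mn : event (noise l x).
    elim: l (x) => [|[B C] l' IH] y /=; first exact: event_cst.
    by apply: event_and; [exact: mchi|apply: event_and; [exact: mj|]].
  have mGf : event (fun w => G w && K (eta0 w) && agree x b (eta0 w) u).
    by apply: event_and; [apply: event_and => //; exact: meta0|
       apply: (meta0 (fun eta : config => agree x b eta u)); exact: event_window].
  apply: EFin_inj; rewrite EFinM -!PrE //; last exact: event_and.
  have := GN _ l x mf; rewrite -Gf // => h.
  transitivity (P [set w | G w && (K (eta0 w) && agree x b (eta0 w) u) && noise l x w]).
    by congr (P _); apply/seteqP; split=> w /=; rewrite andbA.
  by rewrite h; congr (P _ * _)%E; apply/seteqP; split=> w /=; rewrite andbA.
Qed.

End FromRealization.

(** Invariance jointly with the later noise: the new configuration is independent of what drives the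
    next steps, so the process can be restarted at time 1. *)
Definition one_step_invariant {R : realType} (b1 b2 : R) (nu : probability config R) : Prop :=
  forall (d : measure_display) (T : measurableType d) (P : probability T R)
         (eta0 : T -> config) chi j (s : seq sv_index) (E : sv_index -> set T),
    sv_realization b1 b2 nu P eta0 chi j -> uniq s -> all late s ->
    (forall i, i \in s -> sv_events eta0 chi j i (E i)) ->
    forall A : set config, measurable A ->
      P (sv_process eta0 chi j 1 @^-1` A `&` \big[setI/setT]_(i <- s) E i) =
      (nu A * P (\big[setI/setT]_(i <- s) E i))%E.

Lemma sv_process_shift (d : measure_display) (T : measurableType d)
    (eta0 : T -> config) chi j t w :
  sv_process eta0 chi j t.+1 w =
  sv_process (sv_process eta0 chi j 1) (fun t => chi t.+1) (fun t => j t.+1) t w.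
Proof.
elim: t => [//|t IH].
change (sv_step (sv_process eta0 chi j t.+1 w) (fun x => chi t.+2 x w) (fun x => j t.+2 x w)
  = sv_step (sv_process (sv_process eta0 chi j 1) (fun t => chi t.+1) (fun t => j t.+1) t w)
      (fun x => chi t.+2 x w) (fun x => j t.+2 x w)).
by rewrite IH.
Qed.

Section Markov.
Context {R : realType} {b1 b2 : R}.
Hypotheses (b1_01 : 0 < b1 < 1) (b2_01 : 0 < b2 < 1).
Context {nu : probability config R}.
Hypothesis inv : one_step_invariant b1 b2 nu.

Lemma realization_shift (d : measure_display) (T : measurableType d) (P : probability T R)
    (eta0 : T -> config) chi j :
  sv_realization b1 b2 nu P eta0 chi j ->
  sv_realization b1 b2 nu P (sv_process eta0 chi j 1) (fun t => chi t.+1) (fun t => j t.+1).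
Proof.
move=> real; have [[_ [mchi mj]] _ pchi pj ind] := real.
have ev0 (i : sv_index) : i \in [::] -> sv_events eta0 chi j i setT by [].
have P1 A : measurable A -> P (sv_process eta0 chi j 1 @^-1` A) = nu A.
  move=> mA; have := inv real (s := [::]) (E := fun=> setT) isT isT ev0 mA.
  by rewrite !big_nil probability_setT mule1 setIT.
have meta1 : measurable_fun setT (sv_process eta0 chi j 1).
  have [_ [_ M]] := realization_one_step b2_01 real (s := [::]) (E := fun=> setT)
    0 (event_cst true) isT isT ev0.
  by apply: measurable_config => x; exact: (event_next M).
split.
- by split=> //; split=> t x B.
- exact: P1.
- by move=> t x t0; exact: pchi.
- by move=> t x r t0 r0; exact: pj.
move=> s E us used HE.
pose up (i : sv_index) : sv_index := if i is Some (c, (t, x)) then Some (c, (t.+1, x)) else None.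
pose down (i : sv_index) : sv_index := if i is Some (c, (t, x)) then Some (c, (t.-1, x)) else None.
have upK : cancel up down by case=> [[c [t x]]|].
(* The new initial configuration is not one of the basic random elements; it is split off and
   handled by [inv]. *)
pose l := [seq i <- s | i != None].
have ul : uniq l by exact: filter_uniq.
have lS i : i \in l -> i \in s by rewrite mem_filter => /andP[].
pose E' i := E (down i).
have upl : all late (map up l).
  apply/allP => _ /mapP[i il ->]; have := allP used _ (lS _ il).
  by move: il; rewrite mem_filter; case: i => [[c [t x]]|].
have upev i : i \in map up l -> sv_events eta0 chi j i (E' i).
  move=> /mapP[k kl ->]; rewrite /E' upK; have := HE _ (lS _ kl).
  by move: kl; rewrite mem_filter; case: k => [[[] [t x]]|].
have uup : uniq (map up l) by rewrite map_inj_uniq //; exact: can_inj upK.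
have bigE : \big[setI/setT]_(i <- map up l) E' i = \big[setI/setT]_(i <- l) E i.
  by rewrite big_map; apply: eq_bigr => i _; rewrite /E' upK.
have Pl : P (\big[setI/setT]_(i <- l) E i) = (\prod_(i <- l) P (E i))%E.
  rewrite -bigE ind //; first by rewrite big_map; apply: eq_bigr => i _; rewrite /E' upK.
  by apply: sub_all upl => -[[c [t x]]|] //=; exact: ltnW.
have [Ns|Ns] := boolP (None \in s); last first.
  suff -> : s = l by [].
  by apply/esym/all_filterP/allP => i iS; apply/eqP => e; rewrite -e iS in Ns.
have ps : perm_eq s (None :: l).
  apply: uniq_perm => //=; first by rewrite ul andbT mem_filter eqxx.
  by move=> i; rewrite inE mem_filter; case: eqP => [->|].
rewrite !(perm_big _ ps) /= !big_cons -Pl.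
have /= [A mA <-] := HE _ Ns.
have invl := inv real uup upl upev; rewrite bigE in invl.
by rewrite invl // P1.
Qed.

Lemma one_step_invariant_stationary : sv_stationary b1 b2 nu.
Proof.
move=> d T P eta0 chi j real t; elim: t eta0 chi j real => [|t IH] eta0 chi j real A mA.
  by case: real => _ h _ _ _; exact: h.
rewrite -(IH _ _ _ (realization_shift real) A mA); congr (P _).
by apply/seteqP; split=> w /=; rewrite -sv_process_shift.
Qed.

End Markov.

(** * Extremal laws *)

Section Main.
Context {R : realType}.
Variables (b1 b2 : R) (mu : probability config R).
Hypotheses (b1_01 : 0 < b1 < 1) (b2_01 : 0 < b2 < 1).
Hypotheses (ti : translation_invariant mu) (stat : sv_stationary b1 b2 mu).

Local Notation P := (law mu).
Local Notation v := (fun w : space => w.1 : config).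
Local Notation chi := (@real_chi R b1 b2).
Local Notation j := (@real_j R b1 b2).
Local Notation next := (next v (chi 1) (j 1)).

Let real : sv_realization b1 b2 mu P v chi j := realization b1_01 b2_01 mu.

Let model K b : event K -> one_step P b1 b2 v (chi 1) (j 1) (fun w => K (v w)) b.
Proof.
move=> mK; have ev0 (i : sv_index) : i \in [::] -> sv_events v chi j i setT by [].
have [_ [_ M]] := realization_one_step b2_01 real (s := [::]) (E := fun=> setT) b mK isT isT ev0.
rewrite (_ : (fun w => K (v w)) = fun w =>
  `[< (\big[setI/setT]_(i <- [::] : seq sv_index) setT) w >] && K (v w)) //.
by apply/funext => w; rewrite big_nil asboolT.
Qed.

Let model0 b : one_step P b1 b2 v (chi 1) (j 1) (fun=> true) b := model b (event_cst true).

Let Pr_init f : event f -> Pr P (fun w => f (v w)) = Pr mu f.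
Proof. by move=> mf; rewrite /Pr -(law_fst mu mf). Qed.

Let Pr_init_window a b u : Pr P (fun w => agree a b (v w) u) = Pr mu (fun eta : config => agree a b eta u).
Proof. exact: (Pr_init (event_window a b u)). Qed.

Let v_transl (m a b : int) u :
  Pr P (fun w => agree a b (v w) u) = Pr P (fun w => agree (a + m) (b + m) (v w) (transl m u)).
Proof.
rewrite !Pr_init_window -(shift_Pr ti m); last exact: event_window.
apply: eq_Pr => eta; apply: asbool_equiv_eq; split=> h y yab.
  by rewrite /transl -h ?/Defs.shift ?subrK //; lia.
by rewrite /Defs.shift h ?/transl ?addrK //; lia.
Qed.

Let v_stat a b u : Pr P (fun w => agree a b (next^~ w) u) = Pr P (fun w => agree a b (v w) u).
Proof.
rewrite Pr_init_window /Pr -(stat real 1 (event_window a b u)).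
by [].
Qed.

Lemma stationary_exchangeable (a b x y : int) u : a <= x < b -> a <= y < b -> x != y ->
  Pr mu (fun eta : config => agree a b eta (upd (upd u x true) y false)) =
  Pr mu (fun eta : config => agree a b eta (upd (upd u x false) y true)).
Proof.
move=> xab yab xy; rewrite -!Pr_init_window.
exact: (pattern_exchange b1_01 b2_01 model0 v_transl v_stat).
Qed.

Let exch := stationary_exchangeable.

(* The step to the left of [n] does not see the site [n], so that the new
   configuration there and the old value at [n] have the initial joint law. *)
Lemma Pr_next_site c (n : nat) a u : a <= n%:Z ->
  Pr P (fun w => (v w n%:Z == c) && agree a n%:Z (next^~ w) u) =
  Pr mu (fun eta : config => (eta n%:Z == c) && agree a n%:Z eta u).
Proof.
move=> an; pose u' := upd u n%:Z c.
have xab : a <= n%:Z <= n%:Z + 1 by lia.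
have := Pr_mix b1_01 b2_01 model0 v_transl v_stat u' xab.
have E f : agree a (n%:Z + 1) f u' = (f n%:Z == c) && agree a n%:Z f u.
  by rewrite agree_recr // agree_updr // /u' /upd eqxx andbC.
rewrite Pr_init_window (eq_Pr mu (fun eta : config => E eta)) => <-.
apply: eq_Pr => w; rewrite [agree n%:Z _ _ _]agree_recl ?ltrDl // agree_nil andbT.
by rewrite agree_updr // /u' /upd eqxx andbC.
Qed.

(** Left of [n], any realization of the conditioned law has the same initial patterns, up to the
    factor [k], as the constructed realization of [mu] with value [c] at [n]. [transfer_Q] carries
    this through the step, and [Pr_next_site] returns to [mu]. *)
Lemma cond_drop_invariant c : 0 < Pr mu (site0 c) -> one_step_invariant b1 b2 (cond_drop mu c).
Proof.
move=> p0 d T P1 eta0 chi' j' s E real' us ls HE A mA.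
have [mG [GfE _]] := realization_one_step b2_01 real' 0 (event_cst true) us ls HE.
pose G w := `[< (\big[setI/setT]_(i <- s) E i) w >].
rewrite -/G in mG GfE.
have GE : [set w | G w] = \big[setI/setT]_(i <- s) E i.
  by apply/seteqP; split=> w /= /asboolP.
have M n : one_step P1 b1 b2 eta0 (chi' 1) (j' 1) G n.
  have [_ [_ M]] := realization_one_step b2_01 real' n (event_cst true) us ls HE.
  rewrite (_ : G = fun w => `[< (\big[setI/setT]_(i <- s) E i) w >] && true) //.
  by apply/funext => w; rewrite andbT.
have TE : [set eta : config | true] = setT by apply/seteqP; split.
suff W : forall (n : nat) u, (0 <= n)%N ->
    Pr P1 (fun w => G w && agree (- n%:Z) n%:Z (sv_process eta0 chi' j' 1 w) u) =
    Pr P1 G * Pr (cond_drop mu c) (fun eta : config => agree (- n%:Z) n%:Z eta u).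
  have := @config_law_unique _ _ _ _ _ P1 (cond_drop mu c) (sv_process eta0 chi' j' 1) id
    G (fun=> true) (Pr P1 G) 0 (event_next (M 0)) event_site mG (event_cst true) (Pr_ge0 _ _).
  rewrite Pr_true mulr1 => /(_ erefl W A mA).
  by rewrite TE GE setIT => ->; rewrite muleC -GE PrE.
move=> n u _; pose b := n%:Z : int.
have M' : one_step P b1 b2 v (chi 1) (j 1) (fun w => v w b == c) (b + 0).
  exact: (model (b + 0) (event_eqb c (event_site b))).
have t0 u' : transl 0 u' = u' by apply/funext => y; rewrite /transl subr0.
pose k := Pr P1 G / Pr mu (site0 c).
have init x u' : x <= b -> Pr P1 (fun w => G w && agree x b (eta0 w) u') =
    k * Pr P (fun w => (v w b == c) && agree (x + 0) (b + 0) (v w) (transl 0 u')).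
  move=> _; rewrite (GfE _ (event_window x b u')) t0 !addr0.
  rewrite (Pr_init (f := fun eta : config => (eta b == c) && agree x b eta u')).
    by rewrite (cond_drop_window exch) // /k; field; rewrite gt_eqF.
  by apply: event_and; [exact: event_eqb (event_site _)|exact: event_window].
have nb : - b <= b <= b by rewrite /b; lia.
have tQ h := transfer_Q (M b) M' init u h nb.
rewrite !addr0 t0 in tQ M'.
have := Q_sum (M b) (- b) b u; rewrite !tQ -mulrDr -(Q_sum M').
have E1 w : mix eta0 (chi' 1) (j' 1) G b (- b) b u w =
    G w && agree (- b) b (sv_process eta0 chi' j' 1 w) u.
  by rewrite /mix agree_nil andbT.
rewrite (eq_Pr P1 E1) => ->.
rewrite (eq_Pr P (g := fun w => (v w b == c) && agree (- b) b (next^~ w) u)); last first.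
  by move=> w; rewrite /mix agree_nil andbT.
rewrite Pr_next_site; last by rewrite /b; lia.
by rewrite (cond_drop_window exch) // /k; field; rewrite gt_eqF.
Qed.

Lemma cond_drop_ti_stationary c : 0 < Pr mu (site0 c) -> ti_stationary b1 b2 (cond_drop mu c).
Proof.
move=> p0; split; first by apply: cond_drop_ti => //; exact: exch.
by apply: one_step_invariant_stationary => //; exact: cond_drop_invariant.
Qed.

Hypothesis extr : ti_stationary_extremal b1 b2 mu.

(** Extremality identifies both conditional laws with [mu] when both values of the site have
    positive probability; otherwise there is no proper mixture and the claim is checked directly. *)
Lemma site0_indep c (A : set config) : measurable A ->
  mu (drop0 @^-1` A `&` [set eta | site0 c eta]) = ((Pr mu (site0 c))%:E * mu A)%E.
Proof.
move=> mA.
have mdA := measurable_drop0 mA; have pE := Pr_site0_false mu.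
have null e : Pr mu (site0 e) = 0 -> mu (drop0 @^-1` A `&` [set eta | site0 e eta]) = 0%E.
  move=> pz; apply/eqP; rewrite eq_le measure_ge0 andbT.
  apply: le_trans (_ : _ <= mu [set eta | site0 e eta])%E _.
    by rewrite le_measure ?inE //; [apply: measurableI => //|]; exact: event_site0.
  by rewrite PrE ?pz //; exact: event_site0.
have full e : Pr mu (site0 e) = 0 ->
    mu (drop0 @^-1` A `&` [set eta | site0 (~~ e) eta]) = mu A.
  move=> pz; rewrite -(drop0_law exch mA).
  have -> : mu (drop0 @^-1` A) = (mu (drop0 @^-1` A `&` [set eta | site0 e eta])
      + mu (drop0 @^-1` A `&` [set eta | site0 (~~ e) eta]))%E.
    rewrite -measureU.
    - rewrite -setIUr setIidl // => eta _ /=; rewrite /site0.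
      by case: (eta 0); case: e {pz}; by [left|right].
    - by apply: measurableI => //; exact: event_site0.
    - by apply: measurableI => //; exact: event_site0.
    - by apply/seteqP; split=> // eta /= [[_ +] [_]]; rewrite /site0; case: (eta 0); case: e {pz}.
  by rewrite (null e pz) add0e.
have [z|nz] := eqVneq (Pr mu (site0 true)) 0.
  case: c; first by rewrite z null // mul0e.
  by rewrite pE z subr0 mul1e (full true).
have [z|nz'] := eqVneq (Pr mu (site0 false)) 0.
  case: c; last by rewrite z null // mul0e.
  rewrite (full false) // (_ : Pr mu (site0 true) = 1) ?mul1e //.
  by move: pE; rewrite z; lra.
have p0 : 0 < Pr mu (site0 true) by rewrite lt_neqAle eq_sym nz Pr_ge0.
have p0' : 0 < Pr mu (site0 false) by rewrite lt_neqAle eq_sym nz' Pr_ge0.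
have p01 : 0 < Pr mu (site0 true) < 1 by rewrite p0 -subr_gt0 -pE.
have [e1 e0] := extr p01 (cond_drop_ti_stationary p0) (cond_drop_ti_stationary p0')
  (fun A mA => cond_drop_mixture exch p01 mA) mA.
have pc : 0 < Pr mu (site0 c) by case: c.
have : cond_drop mu c A = mu A by case: c {pc}.
rewrite (cond_dropE _ pc) => <-.
by rewrite muleCA -EFinM divff ?gt_eqF // mule1.
Qed.

Lemma extremal_Upsilon : is_Upsilon (Pr mu (site0 true)) mu.
Proof.
move=> s b; elim: s => [_|z s IH /= /andP[zs us]].
  by rewrite big_nil -(probability_setT mu); congr (mu _); apply/seteqP; split.
have mcyl (f : int -> int) : measurable [set eta : config | forall x, x \in s -> eta (f x) = b x].
  rewrite (_ : [set _ | _] = \big[setI/setT]_(x <- s) [set eta : config | eta (f x) = b x]).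
    by apply: bigsetI_measurable => x _; exact: measurable_site.
  by rewrite -bigcap_seq; apply/seteqP; split.
(* Position of [x] once [z] is shifted to 0 and deleted: sites beyond [z] move one step further
   left. *)
pose f x : int := if x - z < 0 then x - z else x - z - 1.
pose A : set config := [set eta | forall x, x \in s -> eta (f x) = b x].
have mA : measurable A by exact: mcyl.
have dropE (eta : config) x : x \in s -> drop0 eta (f x) = eta (x - z).
  move=> xs; have xz : x != z by apply: contraNneq zs => <-.
  rewrite /drop0 /f; have [h|h] := ltP (x - z) 0; first by rewrite h.
  by rewrite ifF ?subrK //; move/eqP: xz; lia.
pose X : set config := drop0 @^-1` A `&` [set eta | site0 (b z) eta].
have mdA := measurable_drop0 mA.
have mX : measurable X by apply: measurableI => //; exact: event_site0.
have -> : [set eta : config | forall x, x \in z :: s -> eta x = b x] = Defs.shift z @^-1` X.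
  apply/seteqP; split=> eta /=.
    move=> h; split=> [x xs|].
      by rewrite dropE // /Defs.shift subrK h // inE xs orbT.
    have <- : eta z = b z by apply: h; rewrite inE eqxx.
    by rewrite /= /site0 /Defs.shift add0r.
  move=> [hA /eqP hz] x; rewrite inE => /orP[/eqP ->|xs].
    by move: hz; rewrite /Defs.shift add0r.
  by have := hA x xs; rewrite dropE // /Defs.shift subrK.
rewrite ti // site0_indep // big_cons EFinM -IH //.
(* [drop0_law] and translation invariance undo the relabelling of the remaining sites. *)
have -> : mu A = mu [set eta : config | forall x, x \in s -> eta x = b x].
  rewrite -(drop0_law exch mA) -(ti z mdA); congr (mu _); apply/seteqP; split=> eta h x xs.
    by have := h x xs; rewrite dropE // /Defs.shift subrK.
  by rewrite dropE // /Defs.shift subrK; exact: h.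
by congr (_%:E * _)%E; case: (b z) => //; exact: Pr_site0_false.
Qed.

End Main.

Theorem theorem3p6 (R : realType) (b1 b2 : R) (mu : probability config R) :
  0 < b1 -> b1 < b2 -> b2 < 1 ->
  translation_invariant mu -> sv_stationary b1 b2 mu ->
  ti_stationary_extremal b1 b2 mu ->
  exists rho : R, 0 <= rho <= 1 /\ is_Upsilon rho mu.
Proof.
move=> b1_gt0 b12 b2_lt1 ti stat extr; exists (Pr mu (site0 true)); split.
  rewrite Pr_ge0 /= -(Pr_true mu); apply: Pr_le => //; exact: event_site0.
apply: (extremal_Upsilon (b1 := b1) (b2 := b2)) => //.
  by rewrite b1_gt0 (lt_trans b12).
by rewrite b2_lt1 (lt_trans b1_gt0).
Qed.
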